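(* Suppose that $\xi_1,\ldots,\xi_n$ are $n$ independent random variables with $\xi_i\sim DGG(\alpha_i,\beta_i,\gamma_i)$, $i=1,2,\ldots,n$ (with $\alpha_i,\beta_i,\gamma_i>0$). Then the product $Z_n=\xi_1\cdots\xi_n$ is M-det if and only if $\sum_{i=1}^n\frac{1}{\beta_i}\le 1$.
   Context: For $\alpha,\beta,\gamma>0$, $\xi\sim DGG(\alpha,\beta,\gamma)$ (double generalized gamma distribution) means that $\xi$ is a random variable in $\mathbb{R}$ with density $f(x)=c\,|x|^{\gamma-1}e^{-\alpha|x|^{\beta}}$, $x\in\mathbb{R}$, where $f(0)=0$ if $\gamma\ne 1$ and $c=\beta\alpha^{\gamma/\beta}/(2\Gamma(\gamma/\beta))$ is the norming constant. A random variable $X$ with distribution function $F$ and moments $m_k=\mathbf{E}[X^k]$ (all finite) is called moment determinate (M-det) if $F$ is the only distribution having the moment sequence $\{m_k\}_{k=1}^\infty$. *)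

(* Defs.v *)
From HB Require Import structures.
From mathcomp Require Import all_boot all_order all_algebra.
From mathcomp Require Import all_classical all_reals all_analysis measurable_realfun.

Set Implicit Arguments.
Unset Strict Implicit.
Unset Printing Implicit Defensive.

Import Order.TTheory GRing.Theory Num.Theory.
Import numFieldNormedType.Exports.

Local Open Scope classical_set_scope.
Local Open Scope ring_scope.

Definition Gamma (R : realType) (s : R) : R :=
  \int[@lebesgue_measure R]_(t in `]0, +oo[) (t `^ (s - 1) * expR (- t)).

(* Since [0 `^ r] is 1 if r = 0 and 0 otherwise, this density vanishes at 0
   when g != 1, and its value there is the norming constant when g = 1. *)
Definition dgg_pdf (R : realType) (a b g x : R) : R :=
  b * a `^ (g / b) / (2 * Gamma (g / b)) *
  (`|x| `^ (g - 1) * expR (- (a * `|x| `^ b))).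

Definition DGG (d : measure_display) (T : measurableType d) (R : realType)
    (P : probability T R) (X : {RV P >-> R}) (a b g : R) : Prop :=
  forall A : set R, measurable A ->
    distribution P X A =
      (\int[@lebesgue_measure R]_(x in A) (dgg_pdf a b g x)%:E)%E.
Arguments DGG {d T R} P X a b g.

(* Mutual (not merely pairwise) independence. *)
Definition independent_RVs (d : measure_display) (T : measurableType d)
    (R : realType) (P : probability T R) (I : finType)
    (X : I -> {RV P >-> R}) : Prop :=
  forall (J : {set I}) (A : I -> set R), (forall i, measurable (A i)) ->
    P (\bigcap_(i in [set i | i \in J]) (X i @^-1` A i)) =
      (\prod_(i in J) P (X i @^-1` A i))%E.
Arguments independent_RVs {d T R} P {I} X.

Definition finite_moments (d : measure_display) (T : measurableType d)
    (R : realType) (P : probability T R) (X : T -> R) : Prop :=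
  forall k : nat, P.-integrable [set: T] (fun w => (X w ^+ k)%:E).

Definition moment (d : measure_display) (T : measurableType d)
    (R : realType) (P : probability T R) (X : T -> R) (k : nat) : \bar R :=
  'E_P[fun w => X w ^+ k].

(* Distributions on the line are Borel probability measures [Q]; the moments
   of [Q] are those of the identity function under [Q]. *)
Definition M_det (d : measure_display) (T : measurableType d) (R : realType)
    (P : probability T R) (X : {RV P >-> R}) : Prop :=
  finite_moments P X /\
  forall Q : probability R R,
    finite_moments Q id ->
    (forall k : nat, (0 < k)%N -> moment Q id k = moment P X k) ->
    forall A : set R, measurable A -> Q A = distribution P X A.
Arguments M_det {d T R} P X.

(* Main.v *)
Require Import Defs.
From HB Require Import structures.
From mathcomp Require Import all_boot all_order all_algebra.
From mathcomp Require Import all_classical all_reals all_analysis measurable_realfun.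
From mathcomp Require Import ring lra.

(** Write s for the sum of the [1 / beta_i].

    The product is determined when [s <= 1] because its moments grow slowly.
    For [x >= 0], [x ^ k] is at most
    [C ^ k * (k!) ^ (1 / b) * exp (a / 2 * x ^ b)] with C depending on a and b
    only, so that a DGG variable with parameters a and b satisfies
    [E |xi| ^ k <= M * C ^ k * (k!) ^ (1 / b)] ([dgg_moment_growth]), and by
    independence such bounds multiply, the exponents of the factorial being
    added ([moment_growthM]).  For the product the exponent is s, and the bound
    is at most [M * C ^ k * k!].  If a second law Q has the same moments, the
    integrals of [x ^ k * cos (t * x + a)] under both laws agree for t = 0; the
    growth bound makes the Taylor expansion of the cosine converge under the
    integral on an interval of fixed length around every t, so that the
    agreement propagates to all t ([cos_moment_eq]).  The integrals of
    [cos (t * x + a)] determine a law: products of such functions are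
    combinations of such functions, hence all polynomials in
    [sin ((x - c) / j)] have the same integrals under both laws, and suitable
    ones converge boundedly to the indicator of [x < c] as j grows
    ([probability_eq_of_cos_integrals]).

    When [s > 1] another law with the same moments is constructed.  The law of
    a DGG variable dominates a measure
    [c * |x| ^ B * exp (- C * |x| ^ r) dx] with [r = b], and this property is
    inherited by independent products, with [1 / r] additive
    ([stretched_minorantM]); for the product, [r = 1 / s < 1].  The
    function [|x| ^ q * exp (- C * |x| ^ r) * sin (b * |x| ^ r)], where
    [b = C * tan (pi * r / 2)] and q is 3 modulo 4, has all its moments equal
    to zero ([oscillation_moment0]): up to sign, its even moments are imaginary
    parts of Gamma integrals along a ray rotated by the angle [pi * r / 2],
    multiplied by a phase that makes them real, and rotating the ray back does
    not change them.  This requires the angle to be less than [pi / 2], that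
    is, [r < 1].  By the minorant, a small multiple of this function can be
    added to the law of the product without losing positivity
    ([stretched_minorant_not_M_det]).

    Both properties pass from the factors to the product one factor at a time,
    as each partial product is independent of the next factor
    ([independent_prod_ind]). *)

Set Implicit Arguments.
Unset Strict Implicit.
Unset Printing Implicit Defensive.

Import Order.TTheory GRing.Theory Num.Theory.
Import numFieldNormedType.Exports.

Local Open Scope classical_set_scope.
Local Open Scope ring_scope.

(** * Integration against a density *)

Section density.
Local Open Scope ereal_scope.
Import HBNNSimple.

(** The two sides agree on indicators by assumption, hence on simple functions,
    and pass to the limit by monotone convergence.  The map [phi] makes the lemma
    applicable to Lebesgue measure, whose underlying measurable type is not
    syntactically the canonical one of [R]. *)
Lemma ge0_integral_density (d d' : measure_display)
    (T : measurableType d) (T' : measurableType d') (R : realType)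
    (mu : {measure set T -> \bar R}) (nu : {measure set T' -> \bar R})
    (phi : T' -> T) (w : T' -> R) (f : T -> \bar R) :
  measurable_fun setT phi -> measurable_fun setT w -> (forall x, 0 <= w x)%R ->
  (forall A, measurable A -> mu A = \int[nu]_(x in phi @^-1` A) (w x)%:E) ->
  measurable_fun setT f -> (forall x, 0 <= f x) ->
  \int[mu]_x f x = \int[nu]_x (f (phi x) * (w x)%:E).
Proof.
move=> mphi mw w0 muE mf f0.
have mew : measurable_fun setT (EFin \o w) by exact/measurable_EFinP.
pose f_ := nnsfun_approx measurableT mf.
transitivity (limn (fun n => \int[mu]_x (f_ n x)%:E)).
  rewrite -monotone_convergence//.
  - by apply: eq_integral => y _; apply/esym/cvg_lim => //; exact: cvg_nnsfun_approx.
  - by move=> n; exact/measurable_EFinP/measurable_funP.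
  - by move=> n y _; rewrite lee_fin.
  - by move=> y _ m n mn; rewrite lee_fin; exact/lefP/nd_nnsfun_approx.
have mfw n : measurable_fun setT (fun x => (f_ n (phi x))%:E * (w x)%:E).
  apply: emeasurable_funM => //; apply/measurable_EFinP.
  exact: measurableT_comp.
rewrite [X in limn X](_ : _ = (fun n => \int[nu]_x ((f_ n (phi x))%:E * (w x)%:E))).
  rewrite -monotone_convergence//; last 2 first.
    - by move=> n x _; rewrite mule_ge0// lee_fin.
    - move=> x _ m n mn; rewrite lee_wpmul2r// ?lee_fin//.
      exact/lefP/nd_nnsfun_approx.
  apply: eq_integral => x _; apply/cvg_lim => //.
  by apply: cvgeZr => //; exact: cvg_nnsfun_approx.
apply/funext => n.
have mfn r : measurable (f_ n @^-1` [set r]) by [].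
have mip r : measurable_fun setT
    (fun x => (\1_(f_ n @^-1` [set r]) (phi x) : R)%:E).
  apply/measurable_EFinP; apply: (measurableT_comp _ mphi).
  exact: measurable_indic.
under eq_integral do rewrite fimfunE -fsumEFin//.
rewrite ge0_integral_fsum//; last 2 first.
  - by move=> y; exact/measurable_EFinP/measurable_funM.
  - by move=> y x _; rewrite nnfun_muleindic_ge0.
transitivity (\int[nu]_x \sum_(r \in range (f_ n))
    ((r * \1_(f_ n @^-1` [set r]) (phi x))%:E * (w x)%:E)); last first.
  apply: eq_integral => x _; rewrite [in RHS]fimfunE -fsumEFin//.
  by rewrite ge0_mule_fsuml// => r; rewrite EFinM nnfun_muleindic_ge0.
rewrite ge0_integral_fsum//; last 2 first.
  - move=> y; apply: emeasurable_funM => //.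
    under eq_fun do rewrite EFinM.
    exact: measurable_funeM.
  - by move=> y x _; rewrite mule_ge0 ?lee_fin// -lee_fin EFinM nnfun_muleindic_ge0.
apply: eq_fsbigr => r /[!inE] -[x _ fxr].
have r0 : (0 <= r)%R by rewrite -fxr.
under eq_integral do rewrite EFinM.
under [RHS]eq_integral do rewrite EFinM -muleA.
have mi : measurable_fun setT (fun x => (\1_(f_ n @^-1` [set r]) x : R)%:E).
  by apply/measurable_EFinP; exact: measurable_indic.
rewrite ge0_integralZl//.
rewrite ge0_integralZl//; last 2 first.
  - exact: emeasurable_funM.
  - by move=> y _; rewrite mule_ge0// lee_fin// indicE.
congr (_ * _); rewrite integral_indic// setIT muE// [LHS]integral_mkcond.
apply: eq_integral => y _; rewrite patchE indicE.
rewrite (_ : (y \in _) = (phi y \in f_ n @^-1` [set r])); last first.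
  by apply/idP/idP; rewrite !inE.
by case: ifP => _; rewrite ?mul1e ?mul0e.
Qed.
End density.

(** * Partial products of independent variables *)

Section independence.
Local Open Scope ereal_scope.
Context (d : measure_display) (T : measurableType d) (R : realType)
  (P : probability T R).

Definition independent_pair (X Y : {mfun T >-> R}) : Prop :=
  forall A B : set R, measurable A -> measurable B ->
    P (X @^-1` A `&` Y @^-1` B) = P (X @^-1` A) * P (Y @^-1` B).

Lemma measurable_pair_RV (X Y : {mfun T >-> R}) :
  measurable_fun setT (fun w => (X w, Y w)).
Proof. by apply: measurable_fun_pair. Qed.

Lemma independent_pairE (X Y : {mfun T >-> R}) (E : set (R * R)) :
  independent_pair X Y -> measurable E ->
  P ((fun w => (X w, Y w)) @^-1` E) =
  (distribution P X \x distribution P Y) E.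
Proof.
move=> XY mE; have mXY := measurable_pair_RV X Y.
pose h : {mfun T >-> (R * R)%type} := mfun_Sub (mem_set mXY).
have -> : P ((fun w => (X w, Y w)) @^-1` E) = distribution P h E by [].
by apply/esym/product_measure_unique => // A B mA mB; rewrite -XY.
Qed.

Lemma ge0_integral_independent_mul (X Y : {mfun T >-> R}) (f : R -> \bar R) :
  independent_pair X Y -> measurable_fun setT f -> (forall x, 0 <= f x) ->
  \int[P]_w f (X w * Y w)%R =
  \int[distribution P X]_x \int[distribution P Y]_y f (x * y)%R.
Proof.
move=> XY mf f0; have mXY := measurable_pair_RV X Y.
have mm : measurable_fun setT (fun z : R * R => f (z.1 * z.2)%R).
  by apply: measurableT_comp => //; apply: measurable_funM.
pose h : {mfun T >-> (R * R)%type} := mfun_Sub (mem_set mXY).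
transitivity (\int[distribution P h]_z f (z.1 * z.2)%R).
  by rewrite ge0_integral_distribution.
transitivity (\int[distribution P X \x distribution P Y]_z f (z.1 * z.2)%R).
  apply: eq_measure_integral => A mA _.
  exact: (independent_pairE XY mA).
by rewrite fubini_tonelli1.
Qed.

(** If an event is independent of the pair (X, Y) on rectangles, it is
    independent of the product of X and Y: for fixed E, both sides are finite
    measures of the preimage of A under multiplication, and they agree on the
    rectangles, which generate the product sigma-algebra. *)
Lemma independent_event_mul (X Y : {mfun T >-> R}) (E : set T) :
  measurable E ->
  (forall A B : set R, measurable A -> measurable B ->
    P (X @^-1` A `&` Y @^-1` B `&` E) = P (X @^-1` A `&` Y @^-1` B) * P E) ->
  forall A : set R, measurable A ->
    P ((fun w => X w * Y w)%R @^-1` A `&` E) =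
    P ((fun w => X w * Y w)%R @^-1` A) * P E.
Proof.
move=> mE XYE A mA; have mXY := measurable_pair_RV X Y.
pose h w := (X w, Y w).
have pE : (0 <= fine (P E))%R by rewrite fine_ge0.
have law (m : {measure set T -> \bar R}) :
    exists m' : {measure set (R * R) -> \bar R}, forall D, m' D = m (h @^-1` D).
  by unshelve (exists (pushforward m h)).
have [m1 m1E] := law (mrestr P mE).
have [m2 m2E'] := law (mscale (NngNum pE) P).
have m2E D : m2 D = P (h @^-1` D) * P E.
  by rewrite m2E' -[X in _ = _ * X]fineK ?fin_num_measure// muleC.
have mm : measurable ((fun z : R * R => z.1 * z.2)%R @^-1` A).
  by rewrite -[X in measurable X]setTI; apply: measurable_funM.
suff : m1 ((fun z : R * R => z.1 * z.2)%R @^-1` A) =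
       m2 ((fun z : R * R => z.1 * z.2)%R @^-1` A) by rewrite m1E m2E.
apply: (measure_unique [set C1 `*` C2 | C1 in measurable & C2 in measurable]
  (fun=> setT)) => //.
- by rewrite measurable_prod_measurableType.
- move=> C D [X1 mX1 [X2 mX2 <-{C}]] [Y1 mY1 [Y2 mY2 <-{D}]].
  exists (X1 `&` Y1); first exact: measurableI.
  by exists (X2 `&` Y2); [exact: measurableI|rewrite setXI].
- by move=> _; exists setT => //; exists setT => //; rewrite setXTT.
- by rewrite bigcup_const.
- by move=> _ [C mC [D mD <-]]; rewrite m1E m2E -XYE.
- move=> _; rewrite m1E -[X in X < _]/(P (setT `&` E)) setTI.
  by rewrite ltey_eq fin_num_measure.
Qed.

Section partial_products.
Variables (n : nat) (xi : 'I_n -> {mfun T >-> R}).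

Definition partial_prod (m : nat) : {mfun T >-> R} :=
  (\prod_(j < n | (j < m)%N) xi j)%R.

Lemma partial_prod0 : partial_prod 0%N = 1%R.
Proof. by rewrite /partial_prod big_pred0. Qed.

Lemma partial_prodS (i : 'I_n) :
  partial_prod i.+1 = (partial_prod i * xi i)%R.
Proof.
rewrite /partial_prod (bigD1 i)//= mulrC; congr (_ * _)%R.
by apply: eq_bigl => j; rewrite ltnS [RHS]ltn_neqAle -val_eqE andbC.
Qed.

Lemma partial_prod_full : partial_prod n = (\prod_(j < n) xi j)%R.
Proof. by apply: eq_bigl => j; rewrite ltn_ord. Qed.

Hypothesis hindep : independent_RVs P xi.

(** The factors with index at least m are kept as arbitrary events, so that the
    induction on m can absorb the m-th factor into the partial product. *)
Lemma partial_prod_indep (m : nat) (J : {set 'I_n}) (A : set R)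
    (B : 'I_n -> set R) :
  (forall j, j \in J -> (m <= j)%N) -> (m <= n)%N ->
  measurable A -> (forall j, measurable (B j)) ->
  P (partial_prod m @^-1` A `&` \bigcap_(j in [set j | j \in J]) (xi j @^-1` B j))
  = P (partial_prod m @^-1` A) *
    P (\bigcap_(j in [set j | j \in J]) (xi j @^-1` B j)).
Proof.
elim: m J A B => [|m IH] J A B Jm mn mA mB.
  rewrite partial_prod0.
  have [A1|A1] := pselect (A 1%R).
    have -> : (1%R : {mfun T >-> R}) @^-1` A = setT by apply/seteqP; split.
    by rewrite setTI probability_setT mul1e.
  have -> : (1%R : {mfun T >-> R}) @^-1` A = set0 by apply/seteqP; split.
  by rewrite set0I measure0 mul0e.
pose i := Ordinal mn.
have iJ : i \notin J by apply/negP => /Jm; rewrite ltnn.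
rewrite (partial_prodS i).
apply: (@independent_event_mul (partial_prod i) (xi i)) => //.
  apply: fin_bigcap_measurable => // j _.
  by rewrite -[X in measurable X]setTI; exact: measurable_funP.
move=> C D mC mD.
pose B' j := if j == i then D else B j.
have mB' j : measurable (B' j) by rewrite /B'; case: ifP.
have Bi : \bigcap_(j in [set j | j \in (i |: J)%SET]) (xi j @^-1` B' j) =
    xi i @^-1` D `&` \bigcap_(j in [set j | j \in J]) (xi j @^-1` B j).
  apply/seteqP; split => [w Hw|w [Hi Hw] j /=].
    split; first by have := Hw i; rewrite /B' eqxx; apply; rewrite /= in_setU1 eqxx.
    move=> j /= jJ; have := Hw j; rewrite /B' ifF; last first.
      by apply/negbTE; apply: contraNneq iJ => <-.
    by apply; rewrite /= in_setU1 jJ orbT.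
  rewrite in_setU1 /B'; case: eqVneq => [-> _|_ /= jJ] //; exact: Hw.
have H1 := IH (i |: J)%SET C B' _ (ltnW mn) mC mB'.
rewrite -setIA -Bi H1; last first.
  by move=> j; rewrite in_setU1 => /orP[/eqP -> //|/Jm /ltnW].
rewrite hindep// big_setU1//= {1}/B' eqxx.
have -> : (\prod_(j in J) P (xi j @^-1` B' j) =
    P (\bigcap_(j in [set j | j \in J]) (xi j @^-1` B j))).
  rewrite hindep//; apply: eq_bigr => j jJ; rewrite /B' ifF//.
  by apply/negbTE; apply: contraNneq iJ => <-.
rewrite muleA; congr (_ * _).
have := IH [set i]%SET C (fun=> D) _ (ltnW mn) mC.
have -> : \bigcap_(j in [set j | j \in [set i]%SET]) (xi j @^-1` D) = xi i @^-1` D.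
  apply/seteqP; split => [w|w Hw j /=]; last by rewrite inE => /eqP ->.
  by apply; rewrite /= inE.
by move=> -> //; move=> j; rewrite inE => /eqP ->.
Qed.

Lemma partial_prod_independent_pair (i : 'I_n) :
  independent_pair (partial_prod i) (xi i).
Proof.
move=> A B mA mB.
have := @partial_prod_indep i [set i]%SET A (fun=> B) _ (ltnW (ltn_ord i)) mA.
have -> : \bigcap_(j in [set j | j \in [set i]%SET]) (xi j @^-1` B) = xi i @^-1` B.
  apply/seteqP; split => [w|w Hw j /=]; last by rewrite inE => /eqP ->.
  by apply; rewrite /= inE.
by apply => //; move=> j; rewrite inE => /eqP ->.
Qed.

(** The form in which independence is used: a property of a variable and of the
    number of its factors holds for the whole product as soon as it survives the
    multiplication by one independent factor. *)
Lemma independent_prod_ind (Phi : nat -> {mfun T >-> R} -> Prop) :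
  Phi 0%N 1%R ->
  (forall (i : 'I_n) (W : {mfun T >-> R}), independent_pair W (xi i) ->
     Phi i W -> Phi i.+1 (W * xi i)%R) ->
  Phi n (\prod_(i < n) xi i)%R.
Proof.
move=> Phi0 PhiS; rewrite -partial_prod_full.
suff : forall m, (m <= n)%N -> Phi m (partial_prod m) by apply.
elim=> [_|m IH mn]; first by rewrite partial_prod0.
have := PhiS (Ordinal mn) _ (@partial_prod_independent_pair (Ordinal mn)).
by rewrite (partial_prodS (Ordinal mn)); apply; exact/IH/ltnW.
Qed.

End partial_products.
End independence.

(** * Scaling and the growth of absolute moments *)

Section scaling.
Context (R : realType).
Local Notation mu := (@lebesgue_measure R).
Local Open Scope ereal_scope.

(** Both sides are measures that agree on half-open intervals. *)
Lemma lebesgue_measure_scale (l : R) (l0 : (0 < l)%R) (A : set R) :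
  measurable A -> mu A = l%:E * mu ((fun x => l * x)%R @^-1` A).
Proof.
move=> mA.
have ml : measurable_fun [set: R] (fun x : R => l * x)%R.
  exact: measurable_funM.
have [m mE] : exists m : {measure set (measurableTypeR R) -> \bar R},
    forall A, m A = l%:E * mu ((fun x => l * x)%R @^-1` A).
  pose lam : {measure set (measurableTypeR R) -> \bar R} :=
    mscale (NngNum (ltW l0)) mu.
  by unshelve (exists (pushforward lam
    ((fun x => l * x)%R : measurableTypeR R -> measurableTypeR R))).
rewrite -mE; apply: lebesgue_measure_unique => // _ [[a b]] _ <-.
rewrite mE.
have -> : (fun x : R => (l * x)%R) @^-1` `]a, b] = `](a / l)%R, (b / l)%R]%classic.
  apply/seteqP; split => x /=; rewrite !in_itv/=;
  by rewrite ltr_pdivrMr// ler_pdivlMr// ![(x * l)%R]mulrC.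
rewrite !lebesgue_measure_itv/= !lte_fin ltr_pM2r ?invr_gt0//.
case: ifPn => _; last by rewrite mule0.
by rewrite -!EFinB -EFinM; congr EFin; field; rewrite gt_eqF.
Qed.

Lemma ge0_integral_scale (l : R) (l0 : (0 < l)%R) (f : R -> \bar R) :
  measurable_fun [set: R] f -> (forall x, 0 <= f x) ->
  \int[mu]_x f x = l%:E * \int[mu]_x f (l * x)%R.
Proof.
move=> mf f0.
have ml : measurable_fun [set: R] (fun x : R => l * x)%R.
  exact: measurable_funM.
have [m mE] : exists m : {measure set (measurableTypeR R) -> \bar R},
    (forall A, m A = mu ((fun x => l * x)%R @^-1` A)) /\
    \int[m]_x f x = \int[mu]_x f (l * x)%R.
  unshelve (exists (pushforward mu
    ((fun x => l * x)%R : measurableTypeR R -> measurableTypeR R))) => //.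
  by split => //; rewrite ge0_integral_pushforward.
rewrite -(mE.2).
transitivity (\int[mscale (NngNum (ltW l0)) m]_x f x); last first.
  by rewrite ge0_integral_mscale.
apply: eq_measure_integral => A mA _.
by rewrite -[RHS]/(l%:E * m A) mE.1; exact: lebesgue_measure_scale.
Qed.
End scaling.

Section absolute_moments.
Local Open Scope ereal_scope.
Context (d : measure_display) (T : measurableType d) (R : realType)
  (P : probability T R).

(** The exponent [s] measures the size of the moments on the scale of powers of
    the factorial; [s = 1] is the borderline of the existence of exponential
    moments. *)
Definition moment_growth (X : {mfun T >-> R}) (s : R) : Prop :=
  exists M C : R, [/\ (0 <= M)%R, (0 < C)%R & forall k : nat,
    \int[P]_w (`|X w| ^+ k)%:E <= (M * C ^+ k * (k`!%:R `^ s))%:E].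

Lemma moment_growth1 : moment_growth 1%R 0.
Proof.
exists 1%R, 1%R; split => // k.
rewrite (_ : (fun w => _) = cst 1); last first.
  by apply/funext => w /=; rewrite (_ : _ w = 1%R)// normr1 expr1n.
by rewrite integral_cst//= mul1e powRr0 expr1n !mulr1 probability_setT.
Qed.

Lemma moment_growthM (X Y : {mfun T >-> R}) (s t : R) :
  independent_pair P X Y -> moment_growth X s -> moment_growth Y t ->
  moment_growth (X * Y)%R (s + t).
Proof.
move=> XY [M [C [M0 C0 HX]]] [N [D [N0 D0 HY]]].
exists (M * N)%R, (C * D)%R; split; [exact: mulr_ge0|exact: mulr_gt0|move=> k].
have mk : measurable_fun [set: R] (fun x : R => (`|x| ^+ k)%:E).
  by apply/measurable_EFinP; apply: measurable_funX; exact: normr_measurable.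
have k0 (x : R) : 0 <= (`|x| ^+ k)%:E by rewrite lee_fin exprn_ge0.
have := @ge0_integral_independent_mul _ _ _ _ X Y _ XY mk k0.
rewrite [X in X = _](_ : _ = \int[P]_w (`|(X * Y)%R w| ^+ k)%:E)// => ->.
under eq_integral => x _.
  under eq_integral do rewrite normrM exprMn EFinM.
  rewrite ge0_integralZl//.
  over.
rewrite ge0_integralZr//; last exact: integral_ge0.
rewrite !ge0_integral_distribution//=.
have -> : (M * N * (C * D) ^+ k * k`!%:R `^ (s + t) =
  (M * C ^+ k * k`!%:R `^ s) * (N * D ^+ k * k`!%:R `^ t))%R.
  rewrite powRD ?pnatr_eq0 -?lt0n ?fact_gt0 ?implybT//.
  by rewrite exprMn; ring.
rewrite EFinM; apply: lee_pmul => //; exact: integral_ge0.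
Qed.
End absolute_moments.

(** * Moments of the DGG distribution *)

Section exponential_bounds.
Context (R : realType).
Implicit Types x y b t : R.

Lemma exprn_le_fact_expR y k : 0 <= y -> y ^+ k <= k`!%:R * expR y.
Proof.
move=> y0; case: k => [|k]; first by rewrite expr0 mul1r -expR0 ler_expR.
have := expR_ge1Dxn k y0; rewrite -ler_pdivrMl ?ltr0n ?fact_gt0// mulrC.
by apply: le_trans; rewrite lerDr.
Qed.

(** The inequality [y ^ k <= k! * exp y] for [y = t * x ^ b], raised to the power
    [1 / b]. *)
Lemma exprn_le_expR_powR x b t k : 0 <= x -> 0 < b -> 0 < t ->
  x ^+ k <= (t `^ b^-1)^-1 ^+ k * k`!%:R `^ b^-1 * expR (t / b * x `^ b).
Proof.
move=> x0 b0 t0; have tb0 : 0 < t `^ b^-1 by exact: powR_gt0.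
have y0 : 0 <= t * x `^ b by rewrite mulr_ge0 ?powR_ge0// ltW.
have := exprn_le_fact_expR k y0.
move=> /(ge0_ler_powR (_ : 0 <= b^-1)); rewrite !nnegrE invr_ge0 (ltW b0).
move=> /(_ isT) /(_ (exprn_ge0 _ y0)).
rewrite mulr_ge0 ?expR_ge0// => /(_ isT).
rewrite -[X in X `^ _ <= _]powR_mulrn// powRAC powR_mulrn ?powR_ge0//.
rewrite powRM ?powR_ge0 ?(ltW t0)//. rewrite -powRrM divff ?gt_eqF// powRr1//.
rewrite powRM ?expR_ge0// -expRM exprMn => H.
rewrite -[X in _ <= X]mulrA exprVn ler_pdivlMl ?exprn_gt0//.
by rewrite [t / b * _]mulrAC.
Qed.

End exponential_bounds.

Section dgg.
Local Open Scope ereal_scope.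
Context (d : measure_display) (T : measurableType d) (R : realType)
  (P : probability T R).
Local Notation mu := (@lebesgue_measure R).

Lemma dgg_const_ge0 (a b g : R) : (0 < b)%R ->
  (0 <= b * a `^ (g / b) / (2 * Gamma (g / b)))%R.
Proof.
move=> b0; rewrite divr_ge0 ?mulr_ge0 ?powR_ge0 ?(ltW b0)//.
by apply: Rintegral_ge0 => t _; rewrite mulr_ge0 ?powR_ge0 ?expR_ge0.
Qed.

Lemma dgg_pdf_ge0 (a b g x : R) : (0 < b)%R -> (0 <= dgg_pdf a b g x)%R.
Proof.
by move=> b0; rewrite mulr_ge0 ?dgg_const_ge0// mulr_ge0 ?powR_ge0 ?expR_ge0.
Qed.

Lemma measurable_abs_powR (r : R) : measurable_fun setT (fun x : R => `|x| `^ r)%R.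
Proof. by apply: (measurableT_comp (measurable_powR r)); exact: normr_measurable. Qed.

Lemma measurable_dgg_pdf (a b g : R) : measurable_fun setT (@dgg_pdf R a b g).
Proof.
apply: measurable_funM => //; apply: measurable_funM.
  exact: measurable_abs_powR.
apply: (measurableT_comp (@measurable_expR R)); apply: measurable_funN.
by apply: measurable_funM => //; exact: measurable_abs_powR.
Qed.

Lemma dgg_ge0_integral (X : {RV P >-> R}) (a b g : R) (f : R -> \bar R) :
  (0 < b)%R -> DGG P X a b g ->
  measurable_fun setT f -> (forall x, 0 <= f x) ->
  \int[P]_w f (X w) = \int[mu]_x (f x * (dgg_pdf a b g x)%:E).
Proof.
move=> b0 hX mf f0.
have -> : \int[P]_w f (X w) = \int[distribution P X]_x f x.
  by rewrite ge0_integral_distribution.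
have mp := measurable_dgg_pdf a b g.
have p0 x : (0 <= dgg_pdf a b g x)%R by exact: dgg_pdf_ge0.
have mid : measurable_fun setT (idfun : measurableTypeR R -> R).
  by move=> _ A mA; rewrite setTI.
exact: (@ge0_integral_density _ _ R (measurableTypeR R) R (distribution P X)
  (@lebesgue_measure R) idfun (dgg_pdf a b g) f mid mp p0 hX mf f0).
Qed.

(** Under the scaling [x = 2 ^ (1 / b) * y] the density times
    [exp (a / 2 * |x| ^ b)] becomes a multiple of the density itself, whose
    integral is 1. *)
Lemma dgg_exp_moment_lty (X : {RV P >-> R}) (a b g : R) :
  (0 < a)%R -> (0 < b)%R -> DGG P X a b g ->
  \int[P]_w (expR (a / 2 * `|X w| `^ b))%:E < +oo.
Proof.
move=> a0 b0 hX.
have me : measurable_fun [set: R] (fun x : R => expR (a / 2 * `|x| `^ b)).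
  apply: (measurableT_comp (@measurable_expR R)).
  by apply: measurable_funM => //; exact: measurable_abs_powR.
have mp := measurable_dgg_pdf a b g.
rewrite (dgg_ge0_integral b0 hX (f := fun x => (expR (a / 2 * `|x| `^ b))%:E));
  [|exact/measurable_EFinP|by move=> x; rewrite lee_fin expR_ge0].
pose l : R := (2 `^ b^-1)%R.
have l0 : (0 < l)%R by exact: powR_gt0.
have lb : (l `^ b = 2)%R by rewrite -powRrM mulVf ?gt_eqF// powRr1.
rewrite (ge0_integral_scale l0); last 2 first.
- by apply: emeasurable_funM; exact/measurable_EFinP.
- by move=> x; rewrite mule_ge0// lee_fin ?expR_ge0 ?dgg_pdf_ge0.
rewrite (_ : \int[mu]_x _ = (l `^ (g - 1))%:E * \int[mu]_x (dgg_pdf a b g x)%:E).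
  have -> : \int[mu]_x (dgg_pdf a b g x)%:E = 1.
    by rewrite -(hX setT)// probability_setT.
  by rewrite mule1 -EFinM ltry.
transitivity (\int[mu]_x ((l `^ (g - 1))%:E * (dgg_pdf a b g x)%:E)); last first.
  rewrite ge0_integralZl ?lee_fin ?powR_ge0//; first exact/measurable_EFinP.
  by move=> x _; rewrite lee_fin dgg_pdf_ge0.
apply: eq_integral => x _; rewrite -!EFinM; congr EFin.
rewrite /dgg_pdf normrM (gtr0_norm l0) !powRM ?(ltW l0)// lb.
have -> : (expR (- (a * (2 * `|x| `^ b))) =
    expR (- (a * `|x| `^ b)) * expR (- (a / 2 * (2 * `|x| `^ b))))%R.
  by rewrite -expRD; congr expR; field.
rewrite [expR (- (a / 2 * _))]expRN.
set F := expR (a / 2 * _); have F0 : F != 0%R by rewrite gt_eqF ?expR_gt0.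
set c := (b * _ / _)%R; set E := expR _; set u := (`|x| `^ _)%R.
by field.
Qed.

Lemma dgg_moment_growth (X : {RV P >-> R}) (a b g : R) :
  (0 < a)%R -> (0 < b)%R -> DGG P X a b g -> moment_growth P X b^-1.
Proof.
move=> a0 b0 hX.
(* the rate for which [exprn_le_expR_powR] involves [exp (a / 2 * |x| ^ b)] *)
pose t := (a * b / 2)%R.
have t0 : (0 < t)%R by rewrite !mulr_gt0.
have := dgg_exp_moment_lty a0 b0 hX.
set I := \int[P]_w _ => Ioo.
have I0 : 0 <= I by apply: integral_ge0 => w _; rewrite lee_fin expR_ge0.
have tb0 : (0 < t `^ b^-1)%R by exact: powR_gt0.
exists (fine I), (t `^ b^-1)^-1%R; split;
  [exact: fine_ge0|by rewrite invr_gt0|move=> k].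
pose K := ((t `^ b^-1)^-1 ^+ k * k`!%:R `^ b^-1)%R.
have K0 : (0 <= K)%R by rewrite mulr_ge0 ?powR_ge0// exprn_ge0// invr_ge0 ltW.
rewrite (_ : (fine I * _ * _)%R = (K * fine I)%R); last by rewrite /K; ring.
have mX : measurable_fun setT (fun w => `|X w|)%R.
  by apply: measurableT_comp => //; exact: normr_measurable.
have me : measurable_fun setT (fun w => (expR (a / 2 * `|X w| `^ b))%:E).
  apply/measurable_EFinP; apply: (measurableT_comp (@measurable_expR R)).
  apply: measurable_funM => //.
  exact: (measurableT_comp (measurable_powR b)).
have e0 w : 0 <= (expR (a / 2 * `|X w| `^ b))%:E by rewrite lee_fin expR_ge0.
rewrite EFinM fineK ?ge0_fin_numE// /I -ge0_integralZl//.
apply: ge0_le_integral => //.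
- by apply/measurable_EFinP; exact: measurable_funX.
- exact: measurable_funeM.
move=> w _; rewrite -EFinM lee_fin.
have := @exprn_le_expR_powR _ `|X w|%R b t k (normr_ge0 _) b0 t0.
by rewrite (_ : (t / b)%R = (a / 2)%R)// /t; field; rewrite gt_eqF.
Qed.

End dgg.

(** * Taylor remainder of the cosine *)

Section cosine_taylor.
Context (R : realType).

(** Integration of a power bound on the derivative, in the form of two
    monotonicity statements; the negative half-line follows by reflection. *)
Lemma abs_le_pow_of_derive (f df : R -> R) (N : nat) :
  (forall u : R, is_derive u 1 f (df u)) -> f 0 = 0 ->
  (forall u, `|df u| <= `|u| ^+ N / N`!%:R) ->
  forall u, `|f u| <= `|u| ^+ N.+1 / N.+1`!%:R.
Proof.
have pos (h dh : R -> R) (M : R -> R) (dM : R -> R) u : 0 <= u ->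
    (forall v : R, is_derive v 1 h (dh v)) ->
    (forall v : R, is_derive v 1 M (dM v)) -> h 0 = 0 -> M 0 = 0 ->
    (forall v, 0 <= v -> dh v <= dM v) -> h u <= M u.
  move=> u0 hh hM h0 M0 hle.
  have dd (v : R) : is_derive v 1 (M - h) (dM v - dh v) by exact: is_deriveB.
  have [|c /[!in_itv]/= /andP[c0 _]] := @MVT_segment R (M - h)
      (fun v => dM v - dh v) 0 u u0 (fun v _ => dd v).
    apply: continuous_subspaceT => v.
    by apply: differentiable_continuous; apply/derivable1_diffP; case: (dd v).
  rewrite -![(M - h) _]/(M _ - h _) h0 M0 !subr0 => E.
  by rewrite -subr_ge0 E mulr_ge0// subr_ge0 hle.
have half (h dh : R -> R) u : 0 <= u ->
    (forall v : R, is_derive v 1 h (dh v)) -> h 0 = 0 ->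
    (forall v, `|dh v| <= `|v| ^+ N / N`!%:R) ->
    `|h u| <= u ^+ N.+1 / N.+1`!%:R.
  move=> u0 hh h0 hb.
  pose M (v : R) := v ^+ N.+1 / N.+1`!%:R.
  have dM (v : R) : is_derive v 1 M (v ^+ N / N`!%:R).
    have -> : M = N.+1`!%:R^-1 *: ((@id R) ^+ N.+1).
      by apply/funext => w; rewrite !fctE /M mulrC.
    apply: is_derive_eq; rewrite /GRing.scale/= mulr1.
    rewrite factS natrM; field.
    by rewrite nat1r !pnatr_eq0 -lt0n fact_gt0.
  have M0 : M 0 = 0 by rewrite /M expr0n mul0r.
  rewrite ler_norml; apply/andP; split.
    rewrite lerNl; apply: (pos (- h) (fun v => - dh v) M) => //.
      by rewrite -[(- h) 0]/(- h 0) h0 oppr0.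
    move=> v v0; have := hb v; rewrite (ger0_norm v0); apply: le_trans.
    by rewrite -normrN ler_norm.
  apply: (pos h dh M) => // v v0.
  by have := hb v; rewrite (ger0_norm v0); apply: le_trans; exact: ler_norm.
move=> hf f0 hb u; have [u0|u0] := leP 0 u.
  by rewrite (ger0_norm u0); exact: (half f df).
have -> : f u = (f \o -%R) (- u) by rewrite /= opprK.
rewrite (ltr0_norm u0); apply: (half _ (fun v => - df (- v))) => //.
- by rewrite oppr_ge0 ltW.
- by move=> v; rewrite -[- df _]mulrN1; apply: is_derive1_comp.
- by rewrite /= oppr0.
- by move=> v; rewrite normrN -(normrN v).
Qed.

(** The remainder of order [N] in the Taylor expansion of the cosine at [y].  The
    [j]-th derivative of the cosine is its shift by [j * pi / 2], so that the
    derivative of a remainder is a remainder of the previous order. *)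
Definition cos_remainder (N : nat) (u y : R) : R :=
  cos (y + u) - \sum_(j < N) u ^+ j / j`!%:R * cos (y + pi / 2 *+ j).

Lemma cos_remainderS (N : nat) (u y : R) :
  cos_remainder N.+1 u y =
  cos_remainder N u y - u ^+ N / N`!%:R * cos (y + pi / 2 *+ N).
Proof. by rewrite /cos_remainder big_ord_recr/= opprD addrA. Qed.

Lemma is_derive_cos_remainder (N : nat) (u y : R) :
  is_derive u 1 (cos_remainder N.+1 ^~ y) (cos_remainder N u (y + pi / 2)).
Proof.
elim: N => [|N IH].
  have -> : cos_remainder 1 ^~ y = (cos \o (fun v => y + v)) - cst (cos y).
    apply/funext => v; rewrite /cos_remainder big_ord1 expr0 fact0 mulr0n.
    by rewrite addr0 divr1 mul1r.
  have dy : is_derive u 1 (fun v => y + v) 1.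
    have -> : (fun v => y + v) = cst y + id by [].
    by apply: is_derive_eq; rewrite add0r.
  apply: is_derive_eq.
  rewrite /cos_remainder big_ord0 !subr0 mulr1 addrAC cosDpihalf//.
have -> : cos_remainder N.+2 ^~ y = cos_remainder N.+1 ^~ y -
    (cos (y + pi / 2 *+ N.+1) / N.+1`!%:R) *: ((@id R) ^+ N.+1).
  apply/funext => v; rewrite cos_remainderS; congr (_ - _).
  by rewrite !fctE /GRing.scale/=; ring.
apply: is_derive_eq; rewrite cos_remainderS; congr (_ - _).
rewrite /GRing.scale/= mulr1 mulrSr [pi / 2 *+ N + _]addrC addrA.
move: (cos _) => c; rewrite factS natrM.
by field; rewrite nat1r !pnatr_eq0 -lt0n fact_gt0.
Qed.

Lemma cos_remainder_le (N : nat) (u y : R) :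
  `|cos_remainder N u y| <= `|u| ^+ N / N`!%:R.
Proof.
elim: N u y => [|N IH] u y.
  by rewrite /cos_remainder big_ord0 subr0 expr0 fact0 divr1 cos_max.
apply: (abs_le_pow_of_derive (f := cos_remainder N.+1 ^~ y)
  (df := fun v => cos_remainder N v (y + pi / 2))) => //.
- by move=> v; exact: is_derive_cos_remainder.
- rewrite /cos_remainder addr0 big_ord_recl/= expr0 fact0 divr1 mul1r mulr0n.
  rewrite addr0 big1 ?addr0 ?subrr// => i _.
  by rewrite expr0n/= mul0r mul0r.
Qed.

End cosine_taylor.

(** * Continuation of trigonometric moments *)

Lemma integrable_realZl (d : measure_display) (T : measurableType d)
    (R : realType) (mu : {measure set T -> \bar R}) (D : set T) (f : T -> R)
    (c : R) : measurable D -> mu.-integrable D (EFin \o f) ->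
  mu.-integrable D (EFin \o (fun x => c * f x)).
Proof.
move=> mD fi; rewrite (_ : EFin \o _ = (fun x => c%:E * (EFin \o f) x)%E)//.
exact: integrableZl.
Qed.

Section trigonometric_moments.
Context (R : realType) (mu : probability R R).
Hypothesis imu : forall k : nat, mu.-integrable [set: R] (fun x => (x ^+ k)%:E).

Definition cos_moment (k : nat) (t a : R) : R :=
  \int[mu]_x (x ^+ k * cos (t * x + a)).

Lemma measurable_cos_affine (t a : R) :
  measurable_fun [set: R] (fun x : R => cos (t * x + a)).
Proof.
apply: (measurableT_comp (continuous_measurable_fun (@continuous_cos R))).
by apply: measurable_funD => //; exact: measurable_funM.
Qed.

Lemma integrable_le_pow (f : R -> R) (c : R) (k : nat) :
  measurable_fun [set: R] f -> (forall x, `|f x| <= c * `|x| ^+ k) ->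
  mu.-integrable [set: R] (EFin \o f).
Proof.
move=> mf fle.
apply: (le_integrable measurableT (f := EFin \o f)
  (g := fun x => (c%:E * (x ^+ k)%:E)%E)).
- exact/measurable_EFinP.
- move=> x _; rewrite /= lee_fin normrM normrX; apply: le_trans (fle x) _.
  by rewrite ler_wpM2r ?exprn_ge0// ler_norm.
- exact: integrableZl.
Qed.

Lemma integrable_cos_moment (k : nat) (t a : R) :
  mu.-integrable [set: R] (EFin \o (fun x => x ^+ k * cos (t * x + a))).
Proof.
apply: (@integrable_le_pow _ 1 k).
  by apply: measurable_funM => //; exact: measurable_cos_affine.
by move=> x; rewrite normrM normrX mulrC ler_wpM2r ?exprn_ge0// cos_max.
Qed.

Lemma measurable_cos_remainder (N : nat) (t a h : R) :
  measurable_fun [set: R] (fun x : R => cos_remainder N (h * x) (t * x + a)).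
Proof.
elim: N => [|N IH].
  rewrite (_ : (fun x => _) = (fun x : R => cos ((t + h) * x + a))).
    exact: measurable_cos_affine.
  by apply/funext => x; rewrite /cos_remainder big_ord0 subr0; congr cos; ring.
rewrite (_ : (fun x => _) = (fun x : R => cos_remainder N (h * x) (t * x + a) -
    h ^+ N / N`!%:R * (x ^+ N * cos (t * x + (a + pi / 2 *+ N))))).
  apply: measurable_funB => //; apply: measurable_funM => //.
  by apply: measurable_funM => //; exact: measurable_cos_affine.
apply/funext => x; rewrite cos_remainderS exprMn addrA; congr (_ - _).
by ring.
Qed.

Lemma integrable_cos_remainder (k N : nat) (t a h : R) :
  mu.-integrable [set: R]
    (EFin \o (fun x => x ^+ k * cos_remainder N (h * x) (t * x + a))).
Proof.
apply: (@integrable_le_pow _ (`|h| ^+ N / N`!%:R) (k + N)%N).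
  by apply: measurable_funM => //; exact: measurable_cos_remainder.
move=> x; rewrite normrM normrX exprD [leRHS]mulrCA ler_wpM2l ?exprn_ge0//.
apply: le_trans (cos_remainder_le _ _ _) _.
by rewrite normrM exprMn mulrAC.
Qed.

Lemma cos_moment_taylor (k N : nat) (t a h : R) :
  \int[mu]_x (x ^+ k * cos_remainder N (h * x) (t * x + a)) =
  cos_moment k (t + h) a -
  \sum_(j < N) h ^+ j / j`!%:R * cos_moment (k + j) t (a + pi / 2 *+ j).
Proof.
elim: N => [|N IH].
  rewrite big_ord0 subr0; apply: eq_Rintegral => x _.
  by rewrite /cos_remainder big_ord0 subr0; congr (_ * cos _); ring.
rewrite big_ord_recr/= opprD addrA -IH /cos_moment.
rewrite -RintegralZl//; last exact: integrable_cos_moment.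
rewrite -RintegralB//; last 2 first.
- exact: integrable_cos_remainder.
- by apply: integrable_realZl => //; exact: integrable_cos_moment.
apply: eq_Rintegral => x _; rewrite cos_remainderS exprMn addrA exprD.
by ring.
Qed.

Lemma cos_moment_taylor_le (k N : nat) (t a h : R) :
  `|cos_moment k (t + h) a -
    \sum_(j < N) h ^+ j / j`!%:R * cos_moment (k + j) t (a + pi / 2 *+ j)|
  <= `|h| ^+ N / N`!%:R * \int[mu]_x (`|x| ^+ (k + N)).
Proof.
rewrite -cos_moment_taylor; apply: le_trans.
  by apply: le_normr_Rintegral => //; exact: integrable_cos_remainder.
have ik : mu.-integrable [set: R] (EFin \o (fun x : R => `|x| ^+ (k + N))).
  apply: (@integrable_le_pow _ 1 (k + N)%N).
    by apply: measurable_funX; exact: normr_measurable.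
  by move=> x; rewrite mul1r normrX normr_id.
rewrite -RintegralZl//; apply: le_Rintegral => //.
- by apply: integrable_norm => //; exact: integrable_cos_remainder.
- exact: integrable_realZl.
move=> x _; rewrite normrM normrX exprD [leRHS]mulrCA ler_wpM2l ?exprn_ge0//.
apply: le_trans (cos_remainder_le _ _ _) _.
by rewrite normrM exprMn mulrAC.
Qed.

End trigonometric_moments.

Section continuation.
Context (R : realType) (P Q : probability R R) (M C : R).
Hypothesis iP : forall k : nat, P.-integrable [set: R] (fun x => (x ^+ k)%:E).
Hypothesis iQ : forall k : nat, Q.-integrable [set: R] (fun x => (x ^+ k)%:E).
Hypothesis PQ : forall k : nat, \int[P]_x (x ^+ k) = \int[Q]_x (x ^+ k).
Hypothesis C0 : 0 < C.
Hypothesis M0 : 0 <= M.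
Hypothesis growth : forall k, ~~ odd k -> \int[P]_x (x ^+ k) <= M * C ^+ k * k`!%:R.

Definition same_cos_moments (t : R) : Prop :=
  forall (k : nat) (a : R), cos_moment P k t a = cos_moment Q k t a.

Lemma le_geometric_le0 (x K : R) : 0 <= K ->
  (forall i : nat, x <= K * 2^-1 ^+ i) -> x <= 0.
Proof.
move=> K0 xK; rewrite leNgt; apply/negP => x0.
have [i Ki] : exists i : nat, K / x < i%:R.
  exists (Num.bound (K / x)); apply: archi_boundP.
  by rewrite divr_ge0// ltW.
have := xK i; rewrite leNgt => /negP; apply.
rewrite exprVn ltr_pdivrMr ?exprn_gt0//.
move: Ki; rewrite ltr_pdivrMr// => /lt_le_trans; apply.
by rewrite mulrC ler_wpM2l ?(ltW x0)// -natrX ler_nat ltnW// ltn_expl.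
Qed.

Lemma cos_moment_zero : same_cos_moments 0.
Proof.
move=> k a; rewrite /cos_moment.
under eq_Rintegral do rewrite mul0r add0r.
under [RHS]eq_Rintegral do rewrite mul0r add0r.
by rewrite (RintegralZr _ measurableT (iP k)) (RintegralZr _ measurableT (iQ k)) PQ.
Qed.

(** Expand both integrals to order [N] at t.  The Taylor sums coincide by
    assumption, and each remainder is at most
    [|h| ^ N / N! * M * C ^ (k + N) * (k + N)!], which decreases geometrically as
    [(k + N)! <= 2 ^ (k + N) * k! * N!].  Only orders with [k + N] even are used,
    where the absolute moment is a moment and is thus common to both laws. *)
Lemma cos_moment_step (t h : R) : `|h| * C <= 4^-1 ->
  same_cos_moments t -> same_cos_moments (t + h).
Proof.
move=> hC st k a; apply/eqP; rewrite -subr_eq0 -normr_eq0.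
rewrite eq_le normr_ge0 andbT.
pose K := 2 * M * k`!%:R * (2 * C) ^+ k * (2 * C * `|h|) ^+ k.
have K0 : 0 <= K.
  by rewrite !mulr_ge0 ?exprn_ge0 ?mulr_ge0// ltW.
apply: (le_geometric_le0 K0) => i.
(* with this choice [k + N] is even and [N] grows with [i] *)
pose N := (k + i.*2)%N.
have ekN : ~~ odd (k + N) by rewrite /N addnA addnn oddD !odd_double.
have even_pow (x : R) : `|x| ^+ (k + N) = x ^+ (k + N).
  by rewrite -normrX ger0_norm// exprn_even_ge0.
have mP : \int[P]_x (`|x| ^+ (k + N)) <= M * C ^+ (k + N) * (k + N)`!%:R.
  by under eq_Rintegral do rewrite even_pow; exact: growth.
have mQ : \int[Q]_x (`|x| ^+ (k + N)) <= M * C ^+ (k + N) * (k + N)`!%:R.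
  by under eq_Rintegral do rewrite even_pow; rewrite -PQ; exact: growth.
have TP := cos_moment_taylor_le iP k N t a h.
have TQ := cos_moment_taylor_le iQ k N t a h.
have S : \sum_(j < N) h ^+ j / j`!%:R * cos_moment P (k + j) t (a + pi / 2 *+ j) =
   \sum_(j < N) h ^+ j / j`!%:R * cos_moment Q (k + j) t (a + pi / 2 *+ j).
  by apply: eq_bigr => j _; rewrite st.
rewrite S in TP.
have b0 : 0 <= `|h| ^+ N / N`!%:R by rewrite divr_ge0 ?exprn_ge0.
move/le_trans: TP => /(_ _ (ler_wpM2l b0 mP)) TP.
move/le_trans: TQ => /(_ _ (ler_wpM2l b0 mQ)) TQ.
have fact_le : (k + N)`!%:R <= 2 ^+ (k + N) * k`!%:R * N`!%:R :> R.
  rewrite -natrX -!natrM ler_nat -(bin_fact (leq_addr N k)) addKn.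
  rewrite -mulnA leq_mul2r; apply/orP; right.
  have := Pascal 1 1 (k + N); rewrite addn1 => ->.
  rewrite (bigD1 (Ordinal (leq_addr N k : (k < (k + N).+1)%N)))//=.
  by rewrite !exp1n !muln1 leq_addr.
have bound : `|h| ^+ N / N`!%:R * (M * C ^+ (k + N) * (k + N)`!%:R) <=
    M * k`!%:R * (2 * C) ^+ k * (2 * C * `|h|) ^+ N.
  apply: le_trans (ler_wpM2l b0 (ler_wpM2l _ fact_le)) _.
    by rewrite mulr_ge0// exprn_ge0// ltW.
  rewrite !exprMn !exprD le_eqVlt; apply/orP; left; apply/eqP.
  by field; rewrite pnatr_eq0 -lt0n fact_gt0.
have hC2 : 2 * C * `|h| <= 2^-1.
  by rewrite mulrC mulrCA -ler_pdivlMl// -invfM -natrM.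
move: TP TQ; set s := \sum_(j < N) _ => TP TQ.
have -> : cos_moment P k (t + h) a - cos_moment Q k (t + h) a =
  (cos_moment P k (t + h) a - s) - (cos_moment Q k (t + h) a - s).
  by rewrite opprB addrA subrK.
apply: le_trans (ler_normB _ _) _.
apply: le_trans (lerD (le_trans TP bound) (le_trans TQ bound)) _.
rewrite (_ : K * _ = (M * k`!%:R * (2 * C) ^+ k *
    ((2 * C * `|h|) ^+ k * 2^-1 ^+ i)) *+ 2); last first.
  by rewrite /K mulr2n; ring.
rewrite -mulr2n lerMn2r/= ler_wpM2l ?mulr_ge0 ?exprn_ge0 ?mulr_ge0 ?(ltW C0)//.
rewrite /N exprD ler_wpM2l ?exprn_ge0 ?mulr_ge0 ?(ltW C0)//.
rewrite -addnn exprD; apply: le_trans (_ : 2^-1 ^+ i * 1 <= _); last by rewrite mulr1.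
have z0 : 0 <= 2 * C * `|h| by rewrite !mulr_ge0// ltW.
apply: ler_pM; rewrite ?exprn_ge0//; first by rewrite lerXn2r// nnegrE.
by rewrite exprn_ile1// (le_trans hC2)// invf_le1// ler1n.
Qed.

(** Divide [t] into steps short enough for [cos_moment_step]. *)
Lemma cos_moment_eq (t : R) : same_cos_moments t.
Proof.
have [n nt] : exists n : nat, `|t| * C * 4 < n%:R.
  exists (Num.bound (`|t| * C * 4)); apply: archi_boundP.
  by rewrite !mulr_ge0// ltW.
have n0 : 0 < n%:R :> R by apply: le_lt_trans nt; rewrite !mulr_ge0// ltW.
have st : `|t / n%:R| * C <= 4^-1.
  rewrite normrM normfV (gtr0_norm n0) mulrAC ler_pdivrMr//.
  by rewrite ler_pdivlMl// mulrC ltW.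
have sn (m : nat) : same_cos_moments (m%:R * (t / n%:R)).
  elim: m => [|m IH]; first by rewrite mul0r; exact: cos_moment_zero.
  by rewrite -natr1 mulrDl mul1r; exact: cos_moment_step.
have := sn n; rewrite mulrC divfK ?gt_eqF//.
Qed.

End continuation.

(** * Polynomial approximation of a step *)

Section step_polynomials.
Context (R : realType).

Lemma bernoulli_ineq (x : R) (n : nat) : -1 <= x -> 1 + n%:R * x <= (1 + x) ^+ n.
Proof.
move=> x1; elim: n => [|n IH]; first by rewrite mul0r addr0.
have y0 : 0 <= 1 + x by rewrite -lerBlDl sub0r.
rewrite exprSr; apply: le_trans (ler_wpM2r y0 IH).
rewrite -natr1 -subr_ge0.
rewrite (_ : _ - _ = n%:R * (x * x)); last by ring.
by rewrite mulr_ge0// -expr2 sqr_ge0.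
Qed.

(** The exponent [n * 2 ^ n] in place of [2 ^ n] makes the limit vanish at the
    point [v = 1 / 2] too, so that atoms there do no harm. *)
Definition step_approx (n : nat) (v : R) : R :=
  (1 - v ^+ n.+1) ^+ (n.+1 * 2 ^ n.+1).

Lemma step_approx_itv (n : nat) (v : R) : 0 <= v <= 1 -> 0 <= step_approx n v <= 1.
Proof.
move=> /andP[v0 v1]; have v2 : 0 <= 1 - v ^+ n.+1 by rewrite subr_ge0 exprn_ile1.
rewrite exprn_ge0//= exprn_ile1// lerBlDr lerDl exprn_ge0//.
Qed.

(** Below [1 / 2] Bernoulli's inequality bounds the defect by [n * (2 * v) ^ n],
    which tends to zero.  From [1 / 2] on, [(1 - x) ^ m <= 1 / (1 + x) ^ m]
    with [x = v ^ n], and [(1 + x) ^ m >= 1 + m * x >= n]. *)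
Lemma step_approx_cvg (v : R) : 0 <= v <= 1 ->
  step_approx n v @[n --> \oo] --> ((v < 2^-1)%R%:R : R).
Proof.
move=> v01; have /andP[v0 v1] := v01.
have [vh|vh] := ltP v 2^-1.
- pose e := 1 - 2 * v.
  have e0 : 0 < e by rewrite subr_gt0 -ltr_pdivlMl// mulr1.
  have lb n : 1 - 2 / e ^+ 2 * harmonic n <= step_approx n v.
    have vn : -1 <= - v ^+ n.+1 by rewrite lerN2 exprn_ile1.
    apply: le_trans (bernoulli_ineq _ vn).
    rewrite mulrN lerD2l lerN2 natrM natrX -[X in X <= _]mulrA -exprMn.
    have r0 : 0 <= 2 * v by rewrite mulr_ge0.
    have y0 : 0 <= n.+1%:R * e by rewrite mulr_ge0// ltW.
    have h1 : (2 * v) ^+ n.+1 <= expR (- (n.+1%:R * e)).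
      rewrite -mulrN expRM_natl lerXn2r ?nnegrE ?expR_ge0//.
      by apply: le_trans (expR_ge1Dx _); rewrite /e opprB addrC subrK.
    have h2 := exprn_le_fact_expR 2 y0.
    have n0 : 0 < n.+1%:R :> R by rewrite ltr0n.
    apply: le_trans (ler_wpM2l (ltW n0) h1) _.
    rewrite expRN ler_pdivrMr ?expR_gt0// /harmonic/=.
    set E := expR _ in h2 *.
    have -> : 2 / e ^+ 2 * n.+1%:R^-1 * E = (2 * E) / (e ^+ 2 * n.+1%:R).
      by field; rewrite nat1r pnatr_eq0 (gt_eqF e0).
    rewrite ler_pdivlMr ?mulr_gt0 ?exprn_gt0//.
    apply: le_trans h2; rewrite exprMn le_eqVlt; apply/orP; left; apply/eqP.
    by ring.
  apply: (@squeeze_cvgr _ _ _ _ (fun n => 1 - 2 / e ^+ 2 * harmonic n) (cst 1)).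
  + apply: nearW => n; rewrite lb/=.
    by have /andP[] := step_approx_itv n v01.
  + rewrite -[X in _ --> X]subr0; apply: cvgB; first exact: cvg_cst.
    rewrite -(mulr0 (2 / e ^+ 2)); apply: cvgM; first exact: cvg_cst.
    exact: cvg_harmonic.
  + exact: cvg_cst.
- apply: (@squeeze_cvgr _ _ _ _ (cst 0) (@harmonic R)).
  + apply: nearW => n /=; have /andP[-> _] := step_approx_itv n v01.
    rewrite /step_approx; set m := (_ * _)%N.
    have vn0 : 0 <= v ^+ n.+1 by rewrite exprn_ge0.
    have h1 : 1 + m%:R * v ^+ n.+1 <= (1 + v ^+ n.+1) ^+ m.
      by apply: bernoulli_ineq; apply: le_trans vn0; rewrite lerN10.
    have h2 : n.+1%:R <= (1 + v ^+ n.+1) ^+ m.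
      apply: le_trans h1; rewrite /m natrM natrX -mulrA -exprMn.
      apply: le_trans (_ : n.+1%:R * 1 <= _); first by rewrite mulr1.
      rewrite -[X in X <= _]add0r; apply: lerD => //.
      by rewrite ler_wpM2l// exprn_ege1// -ler_pdivrMl// mulr1.
    have h3 : (1 - v ^+ n.+1) ^+ m * (1 + v ^+ n.+1) ^+ m <= 1.
      rewrite -exprMn exprn_ile1//.
        by apply: mulr_ge0; [rewrite subr_ge0 exprn_ile1|exact: addr_ge0].
      by rewrite -subr_sqr expr1n lerBlDr lerDl sqr_ge0.
    rewrite /harmonic/= -[X in _ <= X]mul1r ler_pdivlMr ?ltr0n//.
    apply: le_trans h3; rewrite ler_wpM2l// exprn_ge0// subr_ge0 exprn_ile1//.
  + exact: cvg_cst.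
  + exact: cvg_harmonic.
Qed.

End step_polynomials.

(** * A law is determined by its trigonometric integrals *)

Section same_integral.
Context (R : realType) (P Q : probability R R).

Definition same_integral (f : R -> R) : Prop :=
  [/\ P.-integrable [set: R] (EFin \o f), Q.-integrable [set: R] (EFin \o f) &
    \int[P]_x f x = \int[Q]_x f x].

Lemma same_integralD (f g : R -> R) : same_integral f -> same_integral g ->
  same_integral (fun x => f x + g x).
Proof.
move=> [Pf Qf fE] [Pg Qg gE]; split.
- by rewrite (_ : EFin \o _ = (EFin \o f) \+ (EFin \o g))%E//; exact: integrableD.
- by rewrite (_ : EFin \o _ = (EFin \o f) \+ (EFin \o g))%E//; exact: integrableD.
- by rewrite !RintegralD// fE gE.
Qed.

Lemma same_integralZ (c : R) (f : R -> R) : same_integral f ->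
  same_integral (fun x => c * f x).
Proof.
move=> [Pf Qf fE]; split; [exact: integrable_realZl..|].
by rewrite !RintegralZl// fE.
Qed.

Lemma integrable_bounded1 (mu : probability R R) (f : R -> R) :
  measurable_fun [set: R] f -> (forall x, `|f x| <= 1) ->
  mu.-integrable [set: R] (EFin \o f).
Proof.
move=> mf f1; apply: (le_integrable measurableT (g := cst 1%E)).
- exact/measurable_EFinP.
- by move=> x _; rewrite /= normr1 lee_fin.
- exact: finite_measure_integrable_cst.
Qed.

Lemma same_integral_bounded1 (f : R -> R) :
  measurable_fun [set: R] f -> (forall x, `|f x| <= 1) ->
  \int[P]_x f x = \int[Q]_x f x -> same_integral f.
Proof. by move=> mf f1 fE; split => //; exact: integrable_bounded1. Qed.

Lemma same_integral_lim (f_ : nat -> R -> R) (f : R -> R) :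
  (forall n, same_integral (f_ n)) -> (forall n x, `|f_ n x| <= 1) ->
  (forall x, f_ n x @[n --> \oo] --> f x) -> same_integral f.
Proof.
move=> sf f1 cf.
have mf_ n : measurable_fun [set: R] (fun x => (f_ n x)%:E).
  by case: (sf n) => /integrableP[].
have cfE x : (f_ n x)%:E @[n --> \oo] --> (f x)%:E.
  by apply: cvg_EFin; [exact: nearW|exact: cf].
have mf : measurable_fun [set: R] (fun x => (f x)%:E).
  by apply: (emeasurable_fun_cvg (fun n x => (f_ n x)%:E)) => // x _; exact: cfE.
have dom (mu : probability R R) : mu.-integrable [set: R] (EFin \o f) /\
    \int[mu]_x f_ n x @[n --> \oo] --> \int[mu]_x f x.
  have [i1 _ c1] := @dominated_convergence _ _ _ mu setT measurableT
    (fun n x => (f_ n x)%:E) (fun x => (f x)%:E) (EFin \o cst 1) mf_ mf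
    (aeW _ (fun x _ => cfE x))
    (finite_measure_integrable_cst mu 1 measurableT)
    (aeW _ (fun x n _ => f1 n x)).
  split=> //; apply: fine_cvg; rewrite fineK; first exact: c1.
  exact: integrable_fin_num.
have [iP cP] := dom P; have [iQ cQ] := dom Q; split => //.
apply: (cvg_unique _ cP); rewrite //.
have -> // : (fun n => \int[P]_x f_ n x) = (fun n => \int[Q]_x f_ n x).
by apply/funext => n; case: (sf n).
Qed.

Hypothesis PQ : forall t a : R,
  \int[P]_x cos (t * x + a) = \int[Q]_x cos (t * x + a).

(** Product-to-sum: multiplying [cos (s * x + a)] by [sin (t * x + c)] gives a
    combination of two cosines of affine functions of [x]. *)
Lemma same_integral_sin_pow (m : nat) (t c s a : R) :
  same_integral (fun x => sin (t * x + c) ^+ m * cos (s * x + a)).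
Proof.
elim: m s a => [|m IH] s a.
  rewrite (_ : (fun x => _) = (fun x => cos (s * x + a))); last first.
    by apply/funext => x; rewrite expr0 mul1r.
  by apply: same_integral_bounded1;
    [exact: measurable_cos_affine|move=> x; exact: cos_max|].
rewrite (_ : (fun x => _) = (fun x =>
    2^-1 * (sin (t * x + c) ^+ m * cos ((s + t) * x + (a + c - pi / 2))) +
    - 2^-1 * (sin (t * x + c) ^+ m * cos ((s - t) * x + (a - c - pi / 2))))).
  by apply: same_integralD; apply: same_integralZ; exact: IH.
apply/funext => x.
have -> : (s + t) * x + (a + c - pi / 2) = (s * x + a) + (t * x + c) - pi / 2.
  by ring.
have -> : (s - t) * x + (a - c - pi / 2) = (s * x + a) - (t * x + c) - pi / 2.
  by ring.
move: (s * x + a) (t * x + c) => z y.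
by rewrite !cosBpihalf sinD sinB exprSr; field.
Qed.

Lemma same_integral_poly_sin (p : {poly R}) (t c : R) :
  same_integral (fun x => p.[sin (t * x + c)]).
Proof.
suff H : forall m, same_integral (fun x => p.[sin (t * x + c)] * sin (t * x + c) ^+ m).
  have := H 0%N; congr same_integral; apply/funext => x.
  by rewrite expr0 mulr1.
elim/poly_ind: p => [m|p b IH m].
  have := same_integralZ 0 (same_integral_sin_pow 0 t c 0 0).
  by congr same_integral; apply/funext => x; rewrite horner0 !mul0r.
have := same_integralD (IH m.+1)
  (same_integralZ b (same_integral_sin_pow m t c 0 0)).
congr same_integral; apply/funext => x.
rewrite hornerMXaddC mul0r addr0 cos0 exprS. by move: (sin _) => y; ring.
Qed.

Lemma same_integral_sin_neg (t c : R) :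
  same_integral (fun x => (sin (t * x + c) < 0)%R%:R).
Proof.
have v01 (x : R) : 0 <= (1 + sin (t * x + c)) / 2 <= 1.
  have s0 : 0 <= 1 + sin (t * x + c) by rewrite addrC -lerBlDr sub0r sin_geN1.
  rewrite divr_ge0//=.
  by rewrite ler_pdivrMr// mul1r (_ : 2 = 1 + 1)// lerD2l sin_le1.
pose p n : {poly R} :=
  (1 - ((1 + 'X) * (2^-1)%:P) ^+ n.+1) ^+ (n.+1 * 2 ^ n.+1).
have pE n x : (p n).[sin (t * x + c)] = step_approx n ((1 + sin (t * x + c)) / 2).
  by rewrite /p /step_approx !(hornerE, horner_exp).
apply: (@same_integral_lim (fun n x => (p n).[sin (t * x + c)])).
- by move=> n; exact: same_integral_poly_sin.
- move=> n x; rewrite pE; have /andP[? ?] := step_approx_itv n (v01 x).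
  by rewrite ger0_norm.
- move=> x; under eq_fun do rewrite pE.
  rewrite (_ : (sin _ < 0) = ((1 + sin (t * x + c)) / 2 < 2^-1)).
    exact: step_approx_cvg.
  by rewrite ltr_pdivrMr// mulVf// gtrDl.
Qed.

(** For large j the point [(x - c) / j] lies in [(-pi, pi)], where the sign of
    the sine is that of [x - c]. *)
Lemma same_integral_halfline (c : R) : same_integral (fun x => (x < c)%R%:R).
Proof.
apply: (@same_integral_lim
  (fun j x => (sin (j.+1%:R^-1 * x + - (c / j.+1%:R)) < 0)%R%:R)).
- by move=> j; exact: same_integral_sin_neg.
- by move=> n x; case: (_ < 0)%R; rewrite ?normr1 ?normr0.
move=> x; apply: cvg_near_cst; near=> j.
have j0 : 0 < j.+1%:R :> R by [].
have jx : `|x - c| < j.+1%:R.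
  apply: lt_le_trans (_ : j%:R <= _); last by rewrite ler_nat.
  by near: j; exact: nbhs_infty_gtr.
have -> : j.+1%:R^-1 * x + - (c / j.+1%:R) = (x - c) / j.+1%:R by ring.
set y := _ / _.
have pi1 : 1 <= pi :> R by rewrite (le_trans _ (pi_ge2 R))// ler1n.
have y1 : `|y| < pi.
  rewrite /y normrM normfV (gtr0_norm j0) ltr_pdivrMr//.
  by apply: lt_le_trans jx _; rewrite ler_peMl// ltW.
move: y1; rewrite ltr_norml => /andP[y1 y2].
have -> : (x < c) = (y < 0) by rewrite pmulr_llt0 ?invr_gt0// subr_lt0.
congr (_%:R); case: (ltP y 0) => y0.
  by rewrite -oppr_gt0 -sinN sin_gt0_pi// oppr_gt0 y0 ltrNl.
by rewrite ltNge sin_ge0_pi// y0 ltW.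
Unshelve. all: end_near. Qed.

Theorem probability_eq_of_cos_integrals (A : set R) : measurable A -> P A = Q A.
Proof.
move=> mA; apply: (@measure_unique _ _ _ (@RGenInftyO.G R)
  (fun n => `]-oo, n%:R[%classic)) => //.
- exact: RGenInftyO.measurableE.
- move=> _ _ [x ->] [y ->]; exists (Num.min x y).
  by apply/seteqP; split => z /=; rewrite !in_itv/= lt_min => /andP.
- by move=> n; exists n%:R.
- apply/seteqP; split => // x _; exists (Num.bound `|x|) => //=.
  rewrite in_itv/=; apply: le_lt_trans (ler_norm x) _.
  exact: archi_boundP.
- move=> _ [c ->].
  have [_ _] := same_integral_halfline c.
  rewrite /Rintegral.
  have E (mu : probability R R) :
    (\int[mu]_x ((x < c)%R%:R)%:E = mu `]-oo, c[%classic)%E.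
    transitivity (\int[mu]_x (\1_(`]-oo, c[%classic) x)%:E)%E.
      by apply: eq_integral => x _; rewrite indicE mem_setE in_itv.
    by rewrite integral_indic// setIT.
  rewrite !E => H.
  by rewrite -[LHS]fineK ?fin_num_measure// -[RHS]fineK ?fin_num_measure// H.
- by move=> k; rewrite ltey_eq fin_num_measure.
Qed.

End same_integral.

(** * Determinacy from moment growth *)

Section determinacy.
Context (d : measure_display) (T : measurableType d) (R : realType)
  (P : probability T R).

Lemma moment_growth_finite_moments (X : {RV P >-> R}) (s : R) :
  moment_growth P X s -> finite_moments P X.
Proof.
move=> [M [C [M0 C0 H]]] k; apply/integrableP; split.
  by apply/measurable_EFinP; exact: measurable_funX.
under eq_integral do rewrite /= normrX.
exact: le_lt_trans (H k) (ltry _).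
Qed.

(** For [s <= 1] the bound is at most [M * C ^ k * k!], as [cos_moment_eq]
    requires. *)
Lemma moment_growth_M_det (X : {RV P >-> R}) (s : R) :
  s <= 1 -> moment_growth P X s -> M_det P X.
Proof.
move=> s1 HX; split; first exact: (moment_growth_finite_moments HX).
move=> Q fQ mQ A mA.
have fX := moment_growth_finite_moments HX.
have mpow k : measurable_fun [set: R] (fun x : R => (x ^+ k)%:E).
  by apply/measurable_EFinP; exact: exprn_measurable.
have iX k : (distribution P X).-integrable [set: R] (fun x => (x ^+ k)%:E).
  by apply: integrable_pushforward => //; rewrite preimage_setT; exact: fX.
have momX k : (\int[distribution P X]_x (x ^+ k)%:E = \int[P]_w (X w ^+ k)%:E)%E.
  by rewrite integral_distribution//; exact: fX.
have PQ k : \int[distribution P X]_x (x ^+ k) = \int[Q]_x (x ^+ k).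
  rewrite /Rintegral momX; case: k => [|k].
    transitivity (fine (1 : \bar R)).
      congr fine; under eq_integral do rewrite expr0.
      by rewrite integral_cst//= mul1e probability_setT.
    congr fine; under [RHS]eq_integral do rewrite expr0.
    by rewrite integral_cst//= mul1e probability_setT.
  by have := mQ k.+1 isT; rewrite /moment unlock => ->.
have [M [C [M0 C0 H]]] := HX.
apply/esym; apply: probability_eq_of_cos_integrals => // t a.
have gr k : ~~ odd k -> \int[distribution P X]_x (x ^+ k) <= M * C ^+ k * k`!%:R.
  move=> ek; rewrite /Rintegral momX -lee_fin fineK; last first.
    exact: integrable_fin_num (fX k).
  under eq_integral => w _.
    rewrite (_ : X w ^+ k = `|X w| ^+ k); last first.
      by rewrite -normrX ger0_norm// exprn_even_ge0.
    over.
  apply: le_trans (H k) _; rewrite lee_fin ler_wpM2l ?mulr_ge0 ?exprn_ge0 ?(ltW C0)//.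
  have k1 : 1 <= k`!%:R :> R by rewrite ler1n fact_gt0.
  by apply: le_trans (ler_powR k1 s1) _; rewrite powRr1// (le_trans _ k1).
have := @cos_moment_eq R (distribution P X) Q M C iX fQ PQ C0 M0 gr t 0%N a.
have E (mu : probability R R) : cos_moment mu 0 t a = \int[mu]_x cos (t * x + a).
  by apply: eq_Rintegral => x _; rewrite expr0 mul1r.
by rewrite !E.
Qed.

End determinacy.

(** * Multiplicative convolution of densities *)

Section multiplicative_convolution.
Local Open Scope ereal_scope.
Context (R : realType).
Local Notation mu := (@lebesgue_measure R).
Variables (g1 g2 : R -> R).
Hypotheses (mg1 : measurable_fun [set: R] g1) (g10 : forall x, (0 <= g1 x)%R).
Hypotheses (mg2 : measurable_fun [set: R] g2) (g20 : forall x, (0 <= g2 x)%R).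

(** For independent X and Y with densities [g1] and [g2], the integral of this
    kernel over [x] is the part of the density of the product at [z] that comes
    from [X > 0].  The inverse is written as a real power so that its
    measurability follows from that of powers. *)
Definition mult_kernel (x z : R) : R :=
  (\1_(`]0%R, +oo[%classic) x * (g1 x * (x `^ (-1) * g2 (z * x `^ (-1)))))%R.

Lemma measurable_mult_kernel :
  measurable_fun [set: R * R] (fun p : R * R => mult_kernel p.1 p.2).
Proof.
have m1 : measurable_fun [set: R * R] (fun p : R * R => p.1 `^ (-1))%R.
  exact: (measurableT_comp (measurable_powR (-1)%R) measurable_fst).
apply: measurable_funM.
  by apply: measurableT_comp measurable_fst; exact: measurable_indic.
apply: measurable_funM; first exact: (measurableT_comp mg1 measurable_fst).
apply: measurable_funM => //.
by apply: (measurableT_comp mg2); apply: measurable_funM.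
Qed.

Lemma measurable_mult_kernel1 (z : R) : measurable_fun [set: R] (mult_kernel ^~ z).
Proof.
have mp : measurable_fun [set: R] (fun x : R => (x, z)).
  by apply: measurable_fun_pair.
exact: (measurableT_comp measurable_mult_kernel mp).
Qed.

Lemma mult_kernel_ge0 (x z : R) : (0 <= mult_kernel x z)%R.
Proof. by rewrite /mult_kernel !mulr_ge0 ?powR_ge0// indicE. Qed.

Variable f : R -> \bar R.
Hypotheses (mf : measurable_fun [set: R] f) (f0 : forall x, 0 <= f x).

Let mfx (x : R) : measurable_fun [set: R] (fun y => f (x * y)%R * (g2 y)%:E).
Proof.
apply: emeasurable_funM; last exact/measurable_EFinP.
by apply: measurableT_comp => //; exact: measurable_funM.
Qed.

Let fx0 (x y : R) : 0 <= f (x * y)%R * (g2 y)%:E.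
Proof. by rewrite mule_ge0// lee_fin. Qed.

Lemma measurable_integral_mul :
  measurable_fun [set: R] (fun x => \int[mu]_y (f (x * y)%R * (g2 y)%:E)).
Proof.
have mm : measurable_fun [set: R * measurableTypeR R]
    (fun p : R * measurableTypeR R => f (p.1 * p.2)%R * (g2 p.2)%:E).
  apply: emeasurable_funM.
    by apply: measurableT_comp => //; exact: measurable_funM.
  by apply/measurable_EFinP; exact: (measurableT_comp mg2 measurable_snd).
exact: (@measurable_fun_fubini_tonelli_F _ _ _ _ R mu _ mm (fun p => fx0 _ _)).
Qed.

Let integral_substitution (x : R) : (0 < x)%R ->
  \int[mu]_y (f (x * y)%R * (g2 y)%:E) =
  (x^-1)%:E * \int[mu]_z (f z * (g2 (z * x^-1)%R)%:E).
Proof.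
move=> x0; have xi0 : (0 < x^-1)%R by rewrite invr_gt0.
rewrite (ge0_integral_scale xi0 (mfx x) (fx0 x)).
apply: (congr1 (fun t => (x^-1)%:E * t)); apply: eq_integral => z _.
by rewrite mulrA divff ?gt_eqF// mul1r [(z * _)%R]mulrC.
Qed.

(** Substitute [z = x * y] for each positive [x] and exchange the integrals; the
    negative [x] are dropped, whence an inequality. *)
Lemma integral_mult_kernel_le :
  \int[mu]_z (f z * \int[mu]_x (mult_kernel x z)%:E) <=
  \int[mu]_x (\int[mu]_y (f (x * y)%R * (g2 y)%:E) * (g1 x)%:E).
Proof.
have mfk : measurable_fun [set: measurableTypeR R * measurableTypeR R]
    (fun p : measurableTypeR R * measurableTypeR R =>
       f p.2 * (mult_kernel p.1 p.2)%:E).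
  apply: emeasurable_funM.
    exact: (measurableT_comp mf measurable_snd).
  by apply/measurable_EFinP; exact: measurable_mult_kernel.
have fk0 (p : measurableTypeR R * measurableTypeR R) :
    0 <= f p.2 * (mult_kernel p.1 p.2)%:E.
  by rewrite mule_ge0// lee_fin mult_kernel_ge0.
have -> : \int[mu]_z (f z * \int[mu]_x (mult_kernel x z)%:E) =
    \int[mu]_x \int[mu]_z (f z * (mult_kernel x z)%:E).
  rewrite (@fubini_tonelli _ _ (measurableTypeR R) (measurableTypeR R) R mu mu
    _ mfk fk0)/=.
  apply: eq_integral => z _.
  rewrite (@ge0_integralZl _ _ _ mu setT measurableT
    (fun x => (mult_kernel x z)%:E) _ (f z) _ (f0 z))//.
    by apply/measurable_EFinP; exact: measurable_mult_kernel1.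
  by move=> x _; rewrite lee_fin mult_kernel_ge0.
apply: ge0_le_integral => //.
- by move=> x _; apply: integral_ge0 => z _; exact: (fk0 (x, z)).
- exact: (@measurable_fun_fubini_tonelli_F _ _ _ _ R mu _ mfk fk0).
- apply: emeasurable_funM; last exact/measurable_EFinP.
  exact: measurable_integral_mul.
move=> x _; have [x0|x0] := leP x 0%R.
  rewrite integral0_eq; last first.
    move=> z _; rewrite /mult_kernel indicE memNset ?mul0r ?mule0//=.
    by rewrite in_itv/= andbT => /lt_geF; rewrite x0.
  by rewrite mule_ge0 ?lee_fin//; apply: integral_ge0.
rewrite integral_substitution//.
have xi0 : (0 < x^-1)%R by rewrite invr_gt0.
have mfg : measurable_fun [set: R] (fun z => f z * (g2 (z * x^-1)%R)%:E).
  apply: emeasurable_funM => //; apply/measurable_EFinP.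
  by apply: (measurableT_comp mg2); exact: measurable_funM.
have fg0 z : 0 <= f z * (g2 (z * x^-1)%R)%:E by rewrite mule_ge0// lee_fin.
have w0 : (0 <= g1 x * x^-1)%R by rewrite mulr_ge0// ltW.
rewrite muleC muleA -EFinM.
have <- : \int[mu]_z ((g1 x * x^-1)%:E * (f z * (g2 (z * x^-1)%R)%:E)) =
    (g1 x * x^-1)%:E * \int[mu]_z (f z * (g2 (z * x^-1)%R)%:E).
  by rewrite (@ge0_integralZl _ _ _ mu setT measurableT
    (fun z => f z * (g2 (z * x^-1)%R)%:E) mfg _ (fun z _ => fg0 z)).
rewrite le_eqVlt; apply/orP; left; apply/eqP; apply: eq_integral => z _.
rewrite /mult_kernel indicE mem_set/= ?in_itv/= ?x0// mul1r.
by rewrite powR_inv1 ?(ltW x0)// mulrA EFinM muleCA.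
Qed.

End multiplicative_convolution.

(** * Stretched exponential minorants *)

Section lower_bounds.
Local Open Scope ereal_scope.
Context (d : measure_display) (T : measurableType d) (R : realType)
  (P : probability T R).
Local Notation mu := (@lebesgue_measure R).

Definition stretched_exp (c B C r x : R) : R :=
  (c * (`|x| `^ B * expR (- (C * `|x| `^ r))))%R.

Lemma stretched_exp_ge0 (c B C r x : R) : (0 <= c)%R ->
  (0 <= stretched_exp c B C r x)%R.
Proof. by move=> c0; rewrite mulr_ge0// mulr_ge0 ?powR_ge0 ?expR_ge0. Qed.

Lemma measurable_stretched_exp (c B C r : R) :
  measurable_fun [set: R] (stretched_exp c B C r).
Proof.
apply: measurable_funM => //; apply: measurable_funM.
  exact: measurable_abs_powR.
apply: (measurableT_comp (@measurable_expR R)); apply: measurable_funN.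
by apply: measurable_funM => //; exact: measurable_abs_powR.
Qed.

(** The law of [X] dominates the measure with density [stretched_exp c B C r]; it
    is stated through integrals because this is the form that composes with
    Fubini's theorem. *)
Definition stretched_minorant (X : {mfun T >-> R}) (r : R) : Prop :=
  exists c B C : R, [/\ (0 < c)%R, (0 < C)%R &
    forall f : R -> \bar R, measurable_fun setT f -> (forall x, 0 <= f x) ->
      \int[mu]_x (f x * (stretched_exp c B C r x)%:E) <= \int[P]_w f (X w)].

Lemma dgg_stretched_minorant (X : {RV P >-> R}) (a b g : R) :
  (0 < a)%R -> (0 < b)%R -> DGG P X a b g -> stretched_minorant X b.
Proof.
move=> a0 b0 hX; exists (b * a `^ (g / b) / (2 * Gamma (g / b)))%R, (g - 1)%R, a.
split => //; last first.
  by move=> f mf f0; rewrite (dgg_ge0_integral b0 hX mf f0).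
rewrite lt_def dgg_const_ge0// andbT; apply/negP => /eqP c0.
have := hX setT measurableT; rewrite probability_setT.
rewrite (eq_integral (cst 0)); last first.
  by move=> x _; rewrite /dgg_pdf c0 mul0r.
by rewrite integral0 => /eqP; rewrite onee_eq0.
Qed.

(** A real power, of either sign, varies by a bounded factor on [[u, 2 * u]]. *)
Lemma powR_doubling (B u x : R) : (0 < u)%R -> (u <= x <= 2 * u)%R ->
  (Num.min 1 (2 `^ B) * u `^ B <= x `^ B)%R.
Proof.
move=> u0 /andP[ux xu].
have xE : (x = (x / u) * u)%R by rewrite divfK// gt_eqF.
have s1 : (1 <= x / u)%R by rewrite ler_pdivlMr// mul1r.
have s2 : (x / u <= 2)%R by rewrite ler_pdivrMr.
have s0 : (0 <= x / u)%R by rewrite (le_trans _ s1).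
rewrite [X in (_ <= X `^ _)%R]xE powRM ?(ltW u0)// ler_wpM2r ?powR_ge0//.
have [B0|B0] := leP 0%R B.
  by rewrite ge_min -{1}(powRr0 (x / u)) ler_powR.
rewrite ge_min; apply/orP; right.
rewrite -(opprK B) !(powRN _ (- B)%R).
rewrite lef_pV2 ?posrE ?powR_gt0//; last exact: lt_le_trans s1.
by rewrite ge0_ler_powR ?nnegrE ?oppr_ge0// ltW.
Qed.

Section kernel.
Variables (c1 B1 C1 r1 c2 B2 C2 r2 : R).
Hypotheses (c10 : (0 < c1)%R) (C10 : (0 < C1)%R) (r10 : (0 < r1)%R).
Hypotheses (c20 : (0 < c2)%R) (C20 : (0 < C2)%R) (r20 : (0 < r2)%R).
Definition kernel_exponent := ((r1^-1 + r2^-1)^-1)%R.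
Let g1 := stretched_exp c1 B1 C1 r1.
Let g2 := stretched_exp c2 B2 C2 r2.
Definition kernel_const := (2^-1 * (c1 * Num.min 1 (2 `^ B1)) *
  (c2 * (Num.min 1 (2 `^ B2) * (2^-1) `^ B2)))%R.
Definition kernel_power :=
  (kernel_exponent / r1 * B1 + kernel_exponent / r2 * B2)%R.
Definition kernel_rate := (C1 * 2 `^ r1 + C2)%R.

(** For [x] between [u = |z| ^ (r / r1)] and [2 * u], both [x ^ r1] and
    [(|z| / x) ^ r2] are at most a constant times [|z| ^ r], since
    [1 / r = 1 / r1 + 1 / r2].  This interval alone gives the bound. *)
Lemma stretched_exp_le_kernel (z : R) : z != 0%R ->
  (stretched_exp kernel_const kernel_power kernel_rate kernel_exponent z)%:E <=
  \int[mu]_x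
    (mult_kernel (stretched_exp c1 B1 C1 r1) (stretched_exp c2 B2 C2 r2) x z)%:E.
Proof.
move=> z0.
set r := kernel_exponent; set c := kernel_const.
set B := kernel_power; set C := kernel_rate.
have az : (0 < `|z|)%R by rewrite normr_gt0.
have i1 : (0 < r1^-1)%R by rewrite invr_gt0.
have i2 : (0 < r2^-1)%R by rewrite invr_gt0.
have r0 : (0 < r)%R by rewrite /r invr_gt0 addr_gt0.
have rE : (r / r1 + r / r2 = 1)%R.
  by rewrite -mulrDr /r /kernel_exponent mulVf// gt_eqF// addr_gt0.
pose u := (`|z| `^ (r / r1))%R; pose v := (`|z| `^ (r / r2))%R.
have u0 : (0 < u)%R by exact: powR_gt0.
have v0 : (0 < v)%R by exact: powR_gt0.
have uv : (u * v = `|z|)%R.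
  by rewrite -powRD ?rE ?oner_eq0// powRr1// ltW.
have ur : (u `^ r1 = `|z| `^ r)%R by rewrite -powRrM divfK// gt_eqF.
have vr : (v `^ r2 = `|z| `^ r)%R by rewrite -powRrM divfK// gt_eqF.
pose K := (stretched_exp c B C r z / u)%R.
have KE x : (u <= x <= 2 * u -> K <= mult_kernel g1 g2 x z)%R.
  move=> /andP[ux xu]; have x0 : (0 < x)%R by exact: lt_le_trans ux.
  have x01 : \1_(`]0%R, +oo[%classic) x = 1%R :> R.
    by rewrite indicE mem_set//= in_itv/= x0.
  rewrite /mult_kernel x01 mul1r powR_inv1 ?(ltW x0)// /g1 /g2.
  have y0 : (0 < `|z| / x)%R by rewrite divr_gt0.
  have yv : (`|z| / x <= v)%R.
    by rewrite ler_pdivrMr// -uv mulrC ler_wpM2l// ltW.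
  have vy : (v / 2 <= `|z| / x)%R.
    rewrite ler_pdivlMr// mulrAC ler_pdivrMr// -uv.
    by rewrite [(u * v)%R]mulrC -mulrA ler_wpM2l ?(ltW v0)// mulrC.
  have L1 : (c1 * (Num.min 1 (2 `^ B1) * u `^ B1 *
      expR (- (C1 * 2 `^ r1 * `|z| `^ r))) <= stretched_exp c1 B1 C1 r1 x)%R.
    rewrite /stretched_exp (gtr0_norm x0) ler_wpM2l ?(ltW c10)//.
    apply: ler_pM; rewrite ?expR_ge0 ?mulr_ge0 ?powR_ge0 ?le_min ?ler01 ?powR_ge0//.
      by apply: powR_doubling => //; rewrite ux.
    rewrite ler_expR lerN2 -mulrA ler_wpM2l ?(ltW C10)// -ur.
    rewrite -powRM ?(ltW u0)//.
    by rewrite ge0_ler_powR ?nnegrE ?mulr_ge0 ?(ltW r10) ?(ltW u0) ?(ltW x0).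
  have L2 : (c2 * (Num.min 1 (2 `^ B2) * (2^-1) `^ B2 * v `^ B2 *
      expR (- (C2 * `|z| `^ r))) <= stretched_exp c2 B2 C2 r2 (z / x))%R.
    rewrite /stretched_exp normrM normfV (gtr0_norm x0) ler_wpM2l ?(ltW c20)//.
    apply: ler_pM; rewrite ?expR_ge0 ?mulr_ge0 ?powR_ge0 ?le_min ?ler01 ?powR_ge0//.
      have v20 : (0 < v / 2)%R by rewrite divr_gt0.
      have v2x : (v / 2 <= `|z| / x <= 2 * (v / 2))%R.
        by rewrite vy/= [X in (_ <= X)%R]mulrC divfK.
      have := powR_doubling B2 v20 v2x.
      by rewrite powRM ?invr_ge0 ?(ltW v0)// [(v `^ B2 * _)%R]mulrC mulrA.
    rewrite ler_expR lerN2 ler_wpM2l ?(ltW C20)// -vr.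
    by rewrite ge0_ler_powR ?nnegrE ?(ltW r20) ?(ltW v0) ?(ltW y0).
  have L3 : ((2 * u)^-1 <= x^-1)%R by rewrite lef_pV2 ?posrE// mulr_gt0.
  have g0 b : (0 <= Num.min 1 (2 `^ b) :> R)%R by rewrite le_min ler01 powR_ge0.
  move: L1 L2; set l1 := (c1 * _)%R; set l2 := (c2 * _)%R => L1 L2.
  have l10 : (0 <= l1)%R.
    by rewrite /l1 !mulr_ge0 ?expR_ge0 ?powR_ge0 ?g0 ?(ltW c10).
  have l20 : (0 <= l2)%R.
    by rewrite /l2 !mulr_ge0 ?expR_ge0 ?powR_ge0 ?g0 ?(ltW c20).
  have u20 : (0 <= (2 * u)^-1)%R by rewrite invr_ge0 mulr_ge0// ltW.
  have L4 : ((2 * u)^-1 * l2 <= x^-1 * stretched_exp c2 B2 C2 r2 (z / x))%R.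
    exact: (ler_pM u20 l20 L3 L2).
  have L5 : (l1 * ((2 * u)^-1 * l2) <= stretched_exp c1 B1 C1 r1 x *
      (x^-1 * stretched_exp c2 B2 C2 r2 (z / x)))%R.
    exact: (ler_pM l10 (mulr_ge0 u20 l20) L1 L4).
  suff -> : K = (l1 * ((2 * u)^-1 * l2))%R by [].
  rewrite /K /stretched_exp /l1 /l2 /c /B /C.
  rewrite /kernel_const /kernel_power /kernel_rate -/r mulrDl opprD expRD.
  rewrite powRD ?(gt_eqF az) ?implybT//.
  rewrite (powRrM `|z| (r / r1)) (powRrM `|z| (r / r2)) -/u -/v.
  move: (expR _) (expR _) (v `^ _)%R (u `^ _)%R (Num.min _ _) (Num.min _ _).
  move=> e1 e2 w1 w2 m1 m2; move: (2^-1 `^ B2)%R => h.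
  by field; rewrite gt_eqF.
have K0 : (0 <= K)%R.
  rewrite divr_ge0 ?(ltW u0)// stretched_exp_ge0// /c /kernel_const.
  have g0 b : (0 <= Num.min 1 (2 `^ b) :> R)%R by rewrite le_min ler01 powR_ge0.
  by rewrite !mulr_ge0 ?powR_ge0// ltW.
have mk : measurable_fun [set: R] (mult_kernel g1 g2 ^~ z).
  by apply: measurable_mult_kernel1; exact: measurable_stretched_exp.
have -> : (stretched_exp c B C r z)%:E = \int[mu]_(x in `[u, (2 * u)%R]%classic) K%:E.
  rewrite integral_cst//= lebesgue_measure_itv/= lte_fin ltr_pMl// ltr1n.
  rewrite -EFinB -EFinM; congr EFin.
  by rewrite /K; field; rewrite gt_eqF.
rewrite integral_mkcond; apply: ge0_le_integral => //.
- by move=> x _; rewrite patchE; case: ifP => //; rewrite lee_fin.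
- by apply/(measurable_restrictT _ _).1 => //; exact: measurable_cst.
- exact/measurable_EFinP.
- move=> x _; rewrite patchE; case: ifPn => [|_]; last first.
    by rewrite lee_fin; apply: mult_kernel_ge0 => ?; rewrite stretched_exp_ge0// ltW.
  by rewrite inE/= in_itv/= => h; rewrite lee_fin KE.
Qed.

End kernel.
End lower_bounds.

Section minorant_product.
Local Open Scope ereal_scope.
Context (d : measure_display) (T : measurableType d) (R : realType)
  (P : probability T R).
Local Notation mu := (@lebesgue_measure R).

(** The minorant of [Y] is applied first, for each value of [X]; the minorant of
    [X] then applies to the function of [X] obtained, and what remains is a
    comparison of integrals with respect to Lebesgue measure. *)
Lemma stretched_minorantM (X Y : {mfun T >-> R}) (r1 r2 : R) :
  (0 < r1)%R -> (0 < r2)%R -> independent_pair P X Y ->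
  stretched_minorant P X r1 -> stretched_minorant P Y r2 ->
  stretched_minorant P (X * Y)%R (r1^-1 + r2^-1)^-1%R.
Proof.
move=> r10 r20 XY [c1 [B1 [C1 [c10 C10 HX]]]] [c2 [B2 [C2 [c20 C20 HY]]]].
have c12 : (0 <= c1 /\ 0 <= c2)%R by split; exact: ltW.
have [c10' c20'] := c12.
exists (kernel_const c1 B1 c2 B2), (kernel_power B1 r1 B2 r2),
  (kernel_rate C1 r1 C2); split.
- rewrite /kernel_const; have g0 b : (0 < Num.min 1 (2 `^ b) :> R)%R.
    by rewrite lt_min ltr01 powR_gt0.
  by rewrite !mulr_gt0 ?powR_gt0 ?invr_gt0.
- by rewrite addr_gt0// mulr_gt0// powR_gt0.
move=> f mf f0.
rewrite (_ : \int[P]_w f ((X * Y)%R w) = \int[P]_w f (X w * Y w)%R)//.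
rewrite (ge0_integral_independent_mul XY mf f0).
pose g1 := stretched_exp c1 B1 C1 r1.
pose g2 := stretched_exp c2 B2 C2 r2.
have mg1 : measurable_fun [set: R] g1 by exact: measurable_stretched_exp.
have mg2 : measurable_fun [set: R] g2 by exact: measurable_stretched_exp.
have g10 x : (0 <= g1 x)%R by exact: stretched_exp_ge0.
have g20 x : (0 <= g2 x)%R by exact: stretched_exp_ge0.
have ker z := @stretched_exp_le_kernel R c1 B1 C1 r1 c2 B2 C2 r2
  c10 C10 r10 c20 C20 r20 z.
have HX' : forall f : R -> \bar R, measurable_fun setT f -> (forall x, 0 <= f x) ->
    \int[mu]_x (f x * (g1 x)%:E) <= \int[P]_w f (X w) by exact: HX.
have HY' : forall f : R -> \bar R, measurable_fun setT f -> (forall x, 0 <= f x) ->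
    \int[mu]_x (f x * (g2 x)%:E) <= \int[P]_w f (Y w) by exact: HY.
rewrite -/g1 -/g2 in ker; move: g1 g2 HX' HY' mg1 mg2 g10 g20 ker.
set c := kernel_const c1 B1 c2 B2; set B := kernel_power B1 r1 B2 r2.
set C := kernel_rate C1 r1 C2; move=> g1 g2 HX' HY' mg1 mg2 g10 g20 ker.
pose F (x : R) := \int[mu]_y (f (x * y)%R * (g2 y)%:E).
have F0 x : 0 <= F x.
  by apply: integral_ge0 => y _; rewrite mule_ge0// lee_fin.
have mF : measurable_fun [set: R] F by exact: measurable_integral_mul.
have mm2 : measurable_fun [set: R * R] (fun p : R * R => f (p.1 * p.2)%R).
  by apply: measurableT_comp => //; exact: measurable_funM.
have mm (x : R) : measurable_fun [set: R] (fun y => f (x * y)%R).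
  by apply: measurableT_comp => //; exact: measurable_funM.
have mG : measurable_fun [set: R] (fun x => \int[distribution P Y]_y f (x * y)%R).
  exact: (@measurable_fun_fubini_tonelli_F _ _ _ _ R (distribution P Y) _ mm2
    (fun p => f0 _)).
apply: (@le_trans _ _ (\int[distribution P X]_x F x)); last first.
  apply: ge0_le_integral => // x _.
  rewrite (ge0_integral_distribution Y (mm x) (fun y => f0 _)).
  exact: (HY' (fun y => f (x * y)%R) (mm x) (fun y => f0 _)).
rewrite ge0_integral_distribution//; apply: le_trans (HX' F mF F0).
apply: le_trans (integral_mult_kernel_le mg1 g10 mg2 g20 mf f0).
have c0 : (0 <= c)%R.
  have h0 b : (0 <= Num.min 1 (2 `^ b) :> R)%R by rewrite le_min ler01 powR_ge0.
  by rewrite /c /kernel_const !mulr_ge0 ?powR_ge0 ?h0 ?(ltW c10) ?(ltW c20).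
have K0 z : 0 <= \int[mu]_x (mult_kernel g1 g2 x z)%:E.
  by apply: integral_ge0 => x _; rewrite lee_fin mult_kernel_ge0.
apply: ae_ge0_le_integral => //.
- by move=> z _; rewrite mule_ge0// lee_fin stretched_exp_ge0.
- apply: emeasurable_funM => //; apply/measurable_EFinP.
  exact: measurable_stretched_exp.
- by move=> z _; rewrite mule_ge0.
- apply: emeasurable_funM => //.
  have mk : measurable_fun [set: measurableTypeR R * measurableTypeR R]
      (fun p => (mult_kernel g1 g2 p.1 p.2)%:E).
    by apply/measurable_EFinP; exact: measurable_mult_kernel.
  apply: (@measurable_fun_fubini_tonelli_G _ _ _ _ R mu _ mk) => p.
  by rewrite lee_fin mult_kernel_ge0.
exists [set 0%R]; split; [by []|exact: lebesgue_measure_set1|].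
move=> z /= Hz; apply: contrapT => /eqP z0; apply: Hz => _.
by rewrite lee_wpmul2l//; exact: ker.
Qed.

End minorant_product.

(** * Rotated Gamma integrals *)

Section rotated_gamma_integral.
Context (R : realType) (q : nat) (s r : R).
Hypotheses (s0 : 0 < s) (r0 : 0 < r).
Local Notation mu := (@lebesgue_measure R).

Local Notation p := (q.+1%:R / r).

(** Up to the substitution [u = s * x ^ r], the integral of [rot_integrand] over
    the half-line is the imaginary part of
    [exp (- i * p * t) * \int u ^ (p - 1) * exp (- exp (- i * t) * u) du] with
    [p = (q + 1) / r], a quantity that does not depend on [t].  This is seen
    from the derivative in [t], [rot_derivative], being up to a constant factor
    the derivative in [x] of [rot_potential]. *)
Definition rot_phase (x t : R) : R := s * x `^ r * sin t - p * t.
Definition rot_damping (x t : R) : R := expR (- (s * x `^ r * cos t)).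
Definition rot_integrand (x t : R) : R :=
  x ^+ q * rot_damping x t * sin (rot_phase x t).
Definition rot_derivative (x t : R) : R := x ^+ q * rot_damping x t *
  (s * x `^ r * sin t * sin (rot_phase x t) +
   (s * x `^ r * cos t - p) * cos (rot_phase x t)).
Definition rot_potential (x t : R) : R :=
  x ^+ q.+1 * rot_damping x t * cos (rot_phase x t).

Lemma is_derive_rot_phase (x t : R) :
  is_derive t 1 (rot_phase x) (s * x `^ r * cos t - p).
Proof.
have -> : rot_phase x = (s * x `^ r) *: @sin R - p *: @id R by [].
by apply: is_derive_eq; rewrite /GRing.scale/= mulr1.
Qed.

Lemma is_derive_rot_damping (x t : R) :
  is_derive t 1 (rot_damping x) (rot_damping x t * (s * x `^ r * sin t)).
Proof.
have -> : rot_damping x = expR \o (- (s * x `^ r) *: @cos R).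
  by apply/funext => u; rewrite /rot_damping /= !fctE -mulNr.
by apply: is_derive_eq; rewrite /rot_damping !fctE /GRing.scale/= mulrNN -mulNr.
Qed.

Lemma is_derive_rot_integrand (x t : R) :
  is_derive t 1 (rot_integrand x) (rot_derivative x t).
Proof.
have dp := is_derive_rot_phase x t; have dd := is_derive_rot_damping x t.
have -> : rot_integrand x = (x ^+ q) *: (rot_damping x * (@sin R \o rot_phase x)).
  by apply/funext => u; rewrite /rot_integrand !fctE /GRing.scale/= mulrA.
apply: is_derive_eq; rewrite /rot_derivative !fctE /GRing.scale/=.
by ring.
Qed.

Lemma is_derive_rot_phase1 (t x : R) : 0 < x ->
  is_derive x 1 (rot_phase ^~ t) (s * sin t * (r * x `^ (r - 1))).
Proof.
move=> x0; have dw := is_derive1_powR r x0.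
have -> : rot_phase ^~ t = (s * sin t) *: (@powR R ^~ r) - cst (p * t).
  by apply/funext => u; rewrite /rot_phase !fctE /GRing.scale/= mulrAC.
by apply: is_derive_eq; rewrite subr0.
Qed.

Lemma is_derive_rot_damping1 (t x : R) : 0 < x ->
  is_derive x 1 (rot_damping ^~ t)
    (rot_damping x t * (- (s * cos t) * (r * x `^ (r - 1)))).
Proof.
move=> x0; have dw := is_derive1_powR r x0.
have E : rot_damping ^~ t = expR \o (- (s * cos t) *: (@powR R ^~ r)).
  apply/funext => u; rewrite /rot_damping /= !fctE /GRing.scale/=.
  by congr expR; ring.
rewrite E; apply: is_derive_eq; rewrite -[rot_damping x t]/((rot_damping ^~ t) x) E.
by rewrite !fctE.
Qed.

Lemma is_derive_rot_potential (t x : R) : 0 < x ->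
  is_derive x 1 (rot_potential ^~ t) (- r * rot_derivative x t).
Proof.
move=> x0; have dp := is_derive_rot_phase1 t x0.
have dd := is_derive_rot_damping1 t x0.
have -> : rot_potential ^~ t =
    (@id R) ^+ q.+1 * ((rot_damping ^~ t) * (@cos R \o (rot_phase ^~ t))).
  by apply/funext => u; rewrite /rot_potential !fctE mulrA.
apply: is_derive_eq; rewrite /rot_derivative !fctE /GRing.scale/= mulr1.
have -> : x `^ r = x * x `^ (r - 1) by rewrite mulr_powRB1// ltW.
rewrite exprS; move: (x `^ _) (cos _) (sin _) (rot_damping _ _) => w c S e.
by field; rewrite gt_eqF.
Qed.

Lemma derivable_rot_derivative (t x : R) : 0 < x ->
  derivable (rot_derivative ^~ t) x 1.
Proof.
move=> x0; have dp := is_derive_rot_phase1 t x0.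
have dd := is_derive_rot_damping1 t x0; have dw := is_derive1_powR r x0.
have -> : rot_derivative ^~ t =
   (@id R) ^+ q * (rot_damping ^~ t) *
   (((s * sin t) *: (@powR R ^~ r)) * (@sin R \o (rot_phase ^~ t)) +
    ((s * cos t) *: (@powR R ^~ r) - cst p) * (@cos R \o (rot_phase ^~ t))).
  apply/funext => u; rewrite /rot_derivative !fctE /GRing.scale/=.
  by rewrite [s * sin t * _]mulrAC [s * cos t * _]mulrAC.
exact: ex_derive.
Qed.

Lemma derivable_rot_integrand (t x : R) : 0 < x ->
  derivable (rot_integrand ^~ t) x 1.
Proof.
move=> x0; have dp := is_derive_rot_phase1 t x0.
have dd := is_derive_rot_damping1 t x0.
have -> : rot_integrand ^~ t =
   (@id R) ^+ q * (rot_damping ^~ t) * (@sin R \o (rot_phase ^~ t)).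
  by apply/funext => u; rewrite /rot_integrand !fctE.
exact: ex_derive.
Qed.

End rotated_gamma_integral.

Section truncated_rotation.
Context (R : realType) (q : nat) (s r : R).
Hypotheses (s0 : 0 < s) (r0 : 0 < r).
Local Notation mu := (@lebesgue_measure R).
Local Notation G := (rot_integrand q s r).
Local Notation dG := (rot_derivative q s r).
Local Notation H := (rot_potential q s r).
Variables (a b : R).
Hypotheses (a0 : 0 < a) (ab : a < b).

Let inab_gt0 x : x \in `[a, b] -> 0 < x.
Proof. by rewrite in_itv/= => /andP[ax _]; exact: lt_le_trans ax. Qed.

Lemma within_continuous_of_derivable (f : R -> R) :
  (forall x, 0 < x -> derivable f x 1) -> {within `[a, b], continuous f}.
Proof.
by move=> df; apply: derivable_within_continuous => x /inab_gt0; exact: df.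
Qed.

Lemma integrable_of_derivable (f : R -> R) :
  (forall x, 0 < x -> derivable f x 1) -> mu.-integrable `[a, b] (EFin \o f).
Proof.
move=> df; apply: continuous_compact_integrable; first exact: segment_compact.
exact: within_continuous_of_derivable.
Qed.

Lemma integral_rot_derivative (t : R) :
  \int[mu]_(x in `[a, b]) dG x t = - r^-1 * (H b t - H a t).
Proof.
pose F (x : R) : R := - r^-1 * H x t.
have dF (x : R) : 0 < x -> is_derive x 1 F (dG x t).
  move=> x0; have dH := is_derive_rot_potential q s r0 t x0.
  have -> : F = - r^-1 *: (H ^~ t) by [].
  apply: is_derive_eq; rewrite /GRing.scale/=; move: (dG x t) => y.
  by field; rewrite gt_eqF.
rewrite /Rintegral (@continuous_FTC2 _ (dG ^~ t) F a b ab).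
- by rewrite -EFinB /= /F mulrBr.
- by apply: within_continuous_of_derivable => x x0; exact: derivable_rot_derivative.
- have cF (x : R) : 0 < x -> {for x, continuous F}.
    move=> x0; apply: differentiable_continuous; apply/derivable1_diffP.
    by case: (dF x x0).
  split.
  + move=> x xab; have x0 : 0 < x by apply: inab_gt0; exact: subset_itv_oo_cc xab.
    by case: (dF x x0).
  + by apply: cvg_at_right_filter; exact: cF.
  + by apply: cvg_at_left_filter; apply: cF; exact: lt_trans ab.
- move=> x xab; have x0 : 0 < x by apply: inab_gt0; exact: subset_itv_oo_cc xab.
  by rewrite derive1E; have dFx := dF x x0; rewrite derive_val.
Qed.

Lemma rot_derivative_bounded : exists K : R, forall x t,
  x \in `[a, b] -> `|dG x t| <= K.
Proof.
pose w := s * b `^ r; have b0 : 0 < b by exact: lt_trans ab.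
have w0 : 0 <= w by rewrite mulr_ge0 ?powR_ge0 ?(ltW s0).
exists (b ^+ q * expR w * (w + (w + q.+1%:R / r))) => x t xab.
have x0 := inab_gt0 xab.
have wx : 0 <= s * x `^ r <= w.
  rewrite mulr_ge0 ?powR_ge0 ?(ltW s0)//= ler_wpM2l ?(ltW s0)//.
  rewrite ge0_ler_powR ?nnegrE ?(ltW r0) ?(ltW x0) ?(ltW b0)//.
  by move: xab; rewrite in_itv/= => /andP[].
rewrite /rot_derivative /rot_damping; move: (rot_phase _ _ _ _ _) => ph.
move: (s * x `^ r) wx => y /andP[y0 yw].
have p0 : 0 <= q.+1%:R / r by rewrite divr_ge0// ltW.
rewrite normrM; apply: ler_pM => //.
  rewrite normrM (ger0_norm (expR_ge0 _)) normrX (gtr0_norm x0).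
  apply: ler_pM; rewrite ?exprn_ge0 ?expR_ge0 ?(ltW x0)//.
    by rewrite lerXn2r ?nnegrE ?(ltW x0) ?(ltW b0)//;
      move: xab; rewrite in_itv => /andP[].
  rewrite ler_expR -mulrN; apply: le_trans yw.
  by rewrite ler_piMr// lerNl cos_geN1.
apply: le_trans (ler_normD _ _) _; apply: lerD.
  rewrite normrM -[leRHS]mulr1; apply: ler_pM => //; last exact: sin_max.
  rewrite normrM (ger0_norm y0) -[leRHS]mulr1; apply: ler_pM => //.
  exact: sin_max.
rewrite normrM -[leRHS]mulr1; apply: ler_pM => //; last exact: cos_max.
apply: le_trans (ler_normB _ _) _; rewrite (ger0_norm p0) lerD2r.
rewrite normrM (ger0_norm y0) -[leRHS]mulr1; apply: ler_pM => //.
exact: cos_max.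
Qed.

(** Differentiation under the integral sign; the derivative of the integrand is
    integrated explicitly by [integral_rot_derivative]. *)
Lemma is_derive_truncated_rot (t : R) :
  is_derive t 1 (fun u => \int[mu]_(x in `[a, b]) G x u)
    (- r^-1 * (H b t - H a t)).
Proof.
have [K dGK] := rot_derivative_bounded.
have dGt x u := is_derive_rot_integrand q s r x u.
have dE u x : partial1of2 (fun u x => G x u) u x = dG x u.
  by rewrite partial1of2E; have d1 := dGt x u; rewrite derive_val.
have Ia : [set` `]t - 1, t + 1[%R] t by rewrite /= in_itv/= ltrBlDr ltrDl ltr01.
have itf u : [set` `]t - 1, t + 1[%R] u -> mu.-integrable `[a, b] (EFin \o (G ^~ u)).
  by move=> _; apply: integrable_of_derivable => x x0; exact: derivable_rot_integrand.
have df u x : [set` `]t - 1, t + 1[%R] u -> [set` `[a, b]] x -> derivable (G x) u 1.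
  by move=> _ _; case: (dGt x u).
have K0 : forall y : R, 0 <= cst `|K| y by [].
have iK : mu.-integrable `[a, b] (EFin \o (cst `|K| : R -> R)).
  by apply: integrable_of_derivable => x _; exact: derivable_cst.
have ub u x : [set` `]t - 1, t + 1[%R] u -> [set` `[a, b]] x ->
    `|partial1of2 (fun u x => G x u) u x| <= cst `|K| x.
  move=> _ xab; rewrite dE; apply: le_trans (dGK x u xab) _; exact: ler_norm.
apply: DeriveDef.
  exact: (@derivable_under_integral R _ _ mu (fun u x => G x u) `[a, b]%classic
    (measurable_itv _) t (t - 1) (t + 1) Ia itf df (cst `|K|) K0 iK ub).
rewrite -derive1E -integral_rot_derivative.
rewrite (@differentiation_under_integral R _ _ mu (fun u x => G x u) `[a, b]%classic
    (measurable_itv _) t (t - 1) (t + 1) Ia itf df (cst `|K|) K0 iK ub).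
by apply: eq_Rintegral => x _; rewrite dE.
Qed.

(** The integral vanishes at angle 0, so that the mean value theorem bounds it by
    the boundary terms. *)
Lemma truncated_rot_le (T : R) : 0 <= T <= pi / 2 ->
  `|\int[mu]_(x in `[a, b]) G x T| <=
  T / r * (b ^+ q.+1 * expR (- (s * b `^ r * cos T)) + a ^+ q.+1).
Proof.
move=> /andP[T0 Tpi].
have [|c] := @MVT_segment R (fun u => \int[mu]_(x in `[a, b]) G x u)
  (fun t => - r^-1 * (H b t - H a t)) 0 T T0 (fun t _ => is_derive_truncated_rot t).
  apply: continuous_subspaceT => t; apply: differentiable_continuous.
  by apply/derivable1_diffP; case: (is_derive_truncated_rot t).
rewrite in_itv/= => /andP[c0 cT].
have -> : \int[mu]_(x in `[a, b]) G x 0 = 0.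
  transitivity (\int[mu]_(x in `[a, b]) (0 : R)).
    apply: eq_Rintegral => x _.
    by rewrite /rot_integrand /rot_phase sin0 !mulr0 subrr sin0 mulr0.
  by rewrite /Rintegral integral0.
rewrite !subr0 => ->.
have b0 : 0 < b by exact: lt_trans ab.
have cos_le : cos T <= cos c.
  have [->//|cneT] := eqVneq c T; rewrite ltW// ltr_cos ?in_itv/= ?c0 ?T0/=.
  - by rewrite lt_neqAle cneT.
  - by rewrite (le_trans cT)// (le_trans Tpi)// ler_pdivrMr// ler_peMr ?pi_ge0// ler1n.
  - by rewrite (le_trans Tpi)// ler_pdivrMr// ler_peMr ?pi_ge0// ler1n.
have cosT0 : 0 <= cos T.
  by rewrite cos_ge0_pihalf// Tpi andbT (le_trans _ T0)// oppr_le0 divr_ge0 ?pi_ge0.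
have Hle x : 0 < x -> `|H x c| <= x ^+ q.+1 * expR (- (s * x `^ r * cos T)).
  move=> x0; rewrite /rot_potential normrM -[leRHS]mulr1.
  apply: ler_pM => //; last exact: cos_max.
  rewrite normrM normrX (gtr0_norm x0) (ger0_norm (expR_ge0 _)).
  rewrite ler_wpM2l ?exprn_ge0 ?(ltW x0)// ler_expR lerN2 ler_wpM2l//.
  by rewrite mulr_ge0 ?powR_ge0// ltW.
have HH : `|H b c - H a c| <=
    b ^+ q.+1 * expR (- (s * b `^ r * cos T)) + a ^+ q.+1.
  apply: le_trans (ler_normB _ _) _; apply: lerD; first exact: Hle.
  apply: le_trans (Hle _ a0) _; rewrite ler_piMr ?exprn_ge0 ?(ltW a0)//.
  by rewrite -expR0 ler_expR oppr_le0 !mulr_ge0 ?powR_ge0// ltW.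
have ri : 0 < r^-1 by rewrite invr_gt0.
rewrite !normrM normrN (ger0_norm T0) (gtr0_norm ri) [leLHS]mulrC mulrA.
by rewrite ler_wpM2l// mulr_ge0// ltW.
Qed.

End truncated_rotation.

(** * Vanishing integrals on the half-line and on the line *)

Section vanishing_integrals.
Context (R : realType).
Local Notation mu := (@lebesgue_measure R).

(** For [x >= 1] a high enough integer power of [x ^ r] exceeds [x ^ e], and it
    is bounded by the exponential. *)
Lemma powR_le_expR_powR (e r c : R) : 0 <= e -> 0 < r -> 0 < c ->
  exists2 K : R, 0 < K & forall x, 0 <= x -> x `^ e <= K * expR (c * x `^ r).
Proof.
move=> e0 r0 c0.
pose j := Num.bound (e / r).
have ej : e <= r * j%:R.
  rewrite mulrC -ler_pdivrMr// ltW//; apply: archi_boundP.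
  by rewrite divr_ge0// ltW.
have k0 : 0 <= j`!%:R / c ^+ j by rewrite divr_ge0// exprn_ge0// ltW.
exists (1 + j`!%:R / c ^+ j); first by rewrite ltr_pwDl.
move=> x x0; have y0 : 0 <= c * x `^ r by rewrite mulr_ge0 ?powR_ge0// ltW.
have e1 : 1 <= expR (c * x `^ r) by rewrite -expR0 ler_expR.
have [x1|x1] := leP x 1.
  have xe1 : x `^ e <= 1.
    have -> : (1 : R) = 1 `^ e by rewrite powR1.
    by rewrite ge0_ler_powR ?nnegrE.
  apply: le_trans xe1 _; rewrite -[leLHS]mulr1; apply: ler_pM => //.
  by rewrite lerDl.
have h := exprn_le_fact_expR j y0.
apply: (@le_trans _ _ (x `^ (r * j%:R))); first by rewrite ler_powR// ltW.
rewrite powRrM powR_mulrn ?powR_ge0//.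
apply: (@le_trans _ _ (j`!%:R / c ^+ j * expR (c * x `^ r))); last first.
  by rewrite ler_wpM2r ?expR_ge0// lerDr.
by rewrite mulrAC ler_pdivlMr ?exprn_gt0// mulrC -exprMn.
Qed.

(** Exhaust the half-line by the intervals from [1 / n] to [n]: the boundary
    terms of [truncated_rot_le] tend to zero at both ends, at infinity because
    [cos T > 0]. *)
Lemma integral_rot_integrand_eq0 (q : nat) (s r T : R) :
  0 < s -> 0 < r -> 0 <= T < pi / 2 ->
  mu.-integrable `]0, +oo[ (EFin \o (rot_integrand q s r ^~ T)) ->
  \int[mu]_(x in `]0, +oo[) rot_integrand q s r x T = 0.
Proof.
move=> s0 r0 /andP[T0 Tpi] iG.
set G := rot_integrand q s r ^~ T.
have cT : 0 < cos T.
  by rewrite cos_gt0_pihalf// Tpi andbT (lt_le_trans _ T0)// oppr_lt0 divr_gt0 ?pi_gt0.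
pose a n : R := n.+2%:R^-1; pose b n : R := n.+2%:R.
have a0 n : 0 < a n by rewrite invr_gt0.
have ab n : a n < b n.
  by apply: (@lt_trans _ _ 1); rewrite ?invf_lt1// ltr1n.
pose D : set R := `]0, +oo[%classic; pose A n : set R := `[a n, b n]%classic.
have mD : measurable D by exact: measurable_itv.
have mA n : measurable (A n) by exact: measurable_itv.
have mG : measurable_fun D G.
  by apply/measurable_EFinP; case/integrableP: iG.
have sub n : A n `<=` D.
  by move=> x; rewrite /A /D /= !in_itv/= andbT => /andP[+ _]; exact: lt_le_trans.
have cvgI : \int[mu]_(x in A n) G x @[n --> \oo] --> \int[mu]_(x in D) G x.
  pose f n (x : R) := (G x * \1_(A n) x)%:E.
  have mf n : measurable_fun D (f n).
    apply/measurable_EFinP; apply: measurable_funM => //.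
  have cf (x : R) : D x -> f n x @[n --> \oo] --> (G x)%:E.
    rewrite /D/= in_itv/= andbT => x0; apply: cvg_near_cst; near=> n.
    rewrite /f indicE mem_set ?mulr1// /A/= in_itv/=; apply/andP; split.
      rewrite /a invf_ple ?posrE//.
      apply: (@le_trans _ _ n%:R); last by rewrite ler_nat -addn2 leq_addr.
      by near: n; exact: nbhs_infty_ger.
    apply: (@le_trans _ _ n%:R); last by rewrite ler_nat -addn2 leq_addr.
    by near: n; exact: nbhs_infty_ger.
  have df (x : R) n : D x -> (`|f n x| <= `|(G x)%:E|)%E.
    move=> _; rewrite /f /= lee_fin normrM ler_piMr// indicE.
    by case: (_ \in _); rewrite ?normr1 ?normr0.
  have mGE : measurable_fun D (fun x => (G x)%:E) by exact/measurable_EFinP.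
  have cfa : {ae mu, forall x, D x -> f ^~ x @ \oo --> (G x)%:E}.
    by apply: aeW => x; exact: cf.
  have dfa : {ae mu, forall x n, D x -> (`|f n x| <= `|(G x)%:E|)%E}.
    by apply: aeW => x n; exact: df.
  have [_ _ c1] := @dominated_convergence _ (measurableTypeR R) _ mu D mD f
    (fun x => (G x)%:E) (fun x => `|(G x)%:E|%E) mf mGE cfa (integrable_abse iG) dfa.
  have fE n : (\int[mu]_(x in D) f n x = \int[mu]_(x in A n) (G x)%:E)%E.
    rewrite -[in RHS](setIidr (@sub n)) integral_mkcondr; apply: eq_integral => x _.
    by rewrite /f patchE indicE; case: ifP => _; rewrite ?mulr1 ?mulr0.
  apply: fine_cvg; rewrite fineK; last exact: integrable_fin_num.
  by move: c1; under eq_fun do rewrite fE.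
have bnd : forall n, `|\int[mu]_(x in `[a n, b n]) G x| <=
  T / r * (b n ^+ q.+1 * expR (- (s * b n `^ r * cos T)) + a n ^+ q.+1).
  by move=> n; apply: truncated_rot_le => //; rewrite T0/= ltW.
have sc0 : 0 < s * cos T by rewrite mulr_gt0.
have [K K0 HK] := @powR_le_expR_powR q.+2%:R r (s * cos T) (ler0n _ _) r0 sc0.
have bnd2 n : `|\int[mu]_(x in `[a n, b n]) G x| <= T / r * (K + 1) * harmonic n.
  apply: le_trans (bnd n) _; rewrite -[leRHS]mulrA ler_wpM2l ?divr_ge0 ?(ltW r0)//.
  have ha : a n <= harmonic n by rewrite /a /harmonic/= lef_pV2 ?posrE// ler_nat.
  rewrite mulrDl mul1r; apply: lerD; last first.
    apply: le_trans ha; rewrite exprS ler_piMr ?(ltW (a0 n))//.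
    by rewrite exprn_ile1 ?(ltW (a0 n))// invf_le1// ler1n.
  apply: (@le_trans _ _ (K * a n)); last by rewrite ler_wpM2l// ltW.
  have b0 : 0 < b n by [].
  have := HK (b n) (ltW b0); rewrite powR_mulrn ?(ltW b0)//.
  rewrite expRN mulrAC => h.
  by rewrite ler_pdivrMr ?expR_gt0// mulrAC ler_pdivlMr// mulrC -exprS.
apply/eqP; rewrite -normr_eq0 eq_le normr_ge0 andbT.
have cn : `|\int[mu]_(x in `[a n, b n]) G x| @[n --> \oo] -->
    `|\int[mu]_(x in `]0, +oo[) G x| by exact: cvg_norm.
have ch : T / r * (K + 1) * harmonic n @[n --> \oo] --> (0 : R).
  rewrite -[X in _ --> X](mulr0 (T / r * (K + 1))).
  by apply: cvgM; [exact: cvg_cst|exact: cvg_harmonic].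
rewrite -(cvg_lim _ cn)// -[leRHS](cvg_lim _ ch)//.
apply: ler_lim;
  [by apply/cvg_ex; eexists; exact: cn|by apply/cvg_ex; eexists; exact: ch|].
by apply: nearW => n; exact: bnd2.
Unshelve. all: end_near. Qed.

Lemma integral_reflect (f : R -> R) : mu.-integrable setT (EFin \o f) ->
  \int[mu]_x f x = \int[mu]_x f (- x).
Proof.
move=> fi; rewrite /Rintegral; congr fine.
have mN : measurable_fun [set: measurableTypeR R]
    (-%R : measurableTypeR R -> measurableTypeR R) by exact: oppr_measurable.
have mf : measurable_fun [set: measurableTypeR R] (EFin \o f).
  by case/integrableP: fi.
have absf (g : R -> \bar R) : measurable_fun [set: measurableTypeR R] g ->
    (forall x, 0 <= g x)%E -> (\int[mu]_x g (- x)%R = \int[mu]_x g x)%E.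
  move=> mg g0.
  transitivity (\int[pushforward mu
      (-%R : measurableTypeR R -> measurableTypeR R)]_x g x)%E.
    by rewrite ge0_integral_pushforward.
  by apply: eq_measure_integral => A mA _; exact: lebesgue_measureN.
rewrite [LHS]integralE [RHS]integralE -[in LHS]absf; last 2 first.
- exact: measurable_funepos.
- by move=> x; exact: funepos_ge0.
rewrite -[X in (_ - X = _)%E]absf; last 2 first.
- exact: measurable_funeneg.
- by move=> x; exact: funeneg_ge0.
by congr (_ - _)%E; apply: eq_integral => x _; rewrite ?funeposE ?funenegE.
Qed.

(** An even function is split into its restriction to the positive half-line
    and the reflection of that; its value at 0 is assumed to be zero so that this
    holds at every point. *)
Lemma integral_half_line_eq0 (f : R -> R) : mu.-integrable setT (EFin \o f) ->
  f 0 = 0 ->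
  (forall x, f (- x) = - f x) \/
  (forall x, f (- x) = f x) /\ \int[mu]_(x in `]0, +oo[) f x = 0 ->
  \int[mu]_x f x = 0.
Proof.
move=> fi f0 [fodd|[feven fpos]].
  have := integral_reflect fi.
  under [X in _ = X -> _]eq_Rintegral do rewrite fodd -mulN1r.
  rewrite RintegralZl// mulN1r => /eqP.
  by rewrite -subr_eq0 opprK -mulr2n mulrn_eq0 => /eqP.
pose p x := f x * \1_(`]0, +oo[%classic) x.
have mp : measurable_fun [set: measurableTypeR R] (EFin \o p).
  apply/measurable_EFinP; apply: measurable_funM.
    by apply/measurable_EFinP; case/integrableP: fi.
  exact: measurable_indic.
have pi : mu.-integrable setT (EFin \o p).
  apply: (le_integrable measurableT mp _ fi) => x _.
  rewrite /= lee_fin normrM ler_piMr// indicE.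
  by case: (_ \in _); rewrite ?normr1 ?normr0.
have mN : measurable_fun [set: measurableTypeR R]
    (-%R : measurableTypeR R -> measurableTypeR R) by exact: oppr_measurable.
have piN : mu.-integrable setT (EFin \o (fun x => p (- x))).
  apply: (le_integrable measurableT _ _ fi) => [|x _].
    exact: (measurableT_comp mp mN).
  rewrite /= lee_fin normrM feven ler_piMr// indicE.
  by case: (_ \in _); rewrite ?normr1 ?normr0.
have pint : \int[mu]_x p x = 0.
  rewrite -fpos [RHS]Rintegral_mkcond; apply: eq_Rintegral => x _.
  by rewrite /p patchE indicE; case: ifP => _; rewrite ?mulr1 ?mulr0.
have fE x : f x = p x + p (- x).
  rewrite /p !indicE; have [x0|x0|->] := ltgtP x 0.
  - rewrite memNset ?mem_set ?feven ?mulr0 ?mulr1 ?add0r//=; rewrite in_itv/= andbT.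
      by rewrite oppr_gt0.
    by apply/negP; rewrite -leNgt ltW.
  - rewrite mem_set ?memNset ?mulr0 ?mulr1 ?addr0//=; rewrite in_itv/= andbT//.
    by apply/negP; rewrite -leNgt oppr_le0 ltW.
  - by rewrite oppr0 f0 !mul0r addr0.
under eq_Rintegral do rewrite fE.
by rewrite RintegralD// -(integral_reflect pi) pint addr0.
Qed.

End vanishing_integrals.

(** * Perturbing a law by a signed density *)

Section density_measure.
Local Open Scope ereal_scope.
Context (R : realType) (w : R -> R).
Hypotheses (mw : measurable_fun [set: R] w) (w0 : forall x, (0 <= w x)%R).
Local Notation mu := (@lebesgue_measure R).

Definition density_measure of (measurable_fun [set: R] w)
  & (forall x, 0 <= w x)%R : set R -> \bar R :=
  fun A => \int[mu]_(x in A) (w x)%:E.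

Local Notation dm := (density_measure mw w0).

Let dm0 : dm set0 = 0. Proof. exact: integral_set0. Qed.

Let dm_ge0 A : 0 <= dm A.
Proof. by apply: integral_ge0 => x _; rewrite lee_fin. Qed.

Let dm_sigma : semi_sigma_additive dm.
Proof.
apply: (@semi_sigma_additive_nng_induced _ (measurableTypeR R) R mu).
  exact/measurable_EFinP.
by move=> x; rewrite lee_fin.
Qed.

HB.instance Definition _ := isMeasure.Build _ _ _ dm dm0 dm_ge0 dm_sigma.

Lemma ge0_integral_density_measure (f : R -> \bar R) :
  measurable_fun setT f -> (forall x, 0 <= f x) ->
  \int[dm]_x f x = \int[mu]_x (f x * (w x)%:E).
Proof.
move=> mf f0; have mid : measurable_fun setT (idfun : measurableTypeR R -> R).
  by move=> _ A mA; rewrite setTI.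
exact: (@ge0_integral_density _ _ R (measurableTypeR R) R dm mu idfun w f mid
  mw w0 (fun A mA => erefl) mf f0).
Qed.

End density_measure.

Section perturbed_law.
Local Open Scope ereal_scope.
Context (R : realType) (nu : probability R R) (g : R -> R).
Local Notation mu := (@lebesgue_measure R).
Hypothesis mg : measurable_fun [set: R] g.
Hypothesis dom : forall f : R -> \bar R, measurable_fun setT f ->
  (forall x, 0 <= f x) -> \int[mu]_x (f x * `|g x|%:E) <= \int[nu]_x f x.
Hypothesis g_int0 : (\int[mu]_x g x = 0)%R.

Let mge : measurable_fun [set: measurableTypeR R] (EFin \o g).
Proof. exact/measurable_EFinP. Qed.

Let g_integrable : mu.-integrable setT (EFin \o g).
Proof.
apply/integrableP; split => //.
have := @dom (cst 1) (measurable_cst _) (fun _ => lee01).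
rewrite integral_cst//= probability_setT mule1.
under eq_integral do rewrite mul1e.
by move=> /le_lt_trans; apply; rewrite ltry.
Qed.

Let gA_integrable (A : set R) : measurable A -> mu.-integrable A (EFin \o g).
Proof. by move=> mA; apply: integrableS g_integrable. Qed.

(** The value on non-measurable sets only has to be nonnegative, as measures
    are functions on all sets. *)
Definition perturbed_law (A : set R) : \bar R :=
  if `[< measurable A >] then nu A + \int[mu]_(x in A) (g x)%:E else 0.

Lemma perturbed_lawE (A : set R) : measurable A ->
  perturbed_law A = nu A + \int[mu]_(x in A) (g x)%:E.
Proof. by move=> mA; rewrite /perturbed_law; case: asboolP. Qed.

Let law0 : perturbed_law set0 = 0.
Proof. by rewrite perturbed_lawE// measure0 integral_set0 adde0. Qed.

Let law_ge0 A : 0 <= perturbed_law A.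
Proof.
rewrite /perturbed_law; case: asboolP => // mA.
have mi : measurable_fun [set: R] (fun x => (\1_A x : R)%:E).
  by apply/measurable_EFinP; exact: measurable_indic.
have i0 x : 0 <= (\1_A x : R)%:E by rewrite lee_fin indicE.
have := dom mi i0 => /=.
rewrite integral_indic// setIT => h.
have h2 : \int[mu]_(x in A) `|(g x)%:E| <= nu A.
  apply: le_trans h; rewrite integral_mkcond le_eqVlt; apply/orP; left; apply/eqP.
    apply: eq_integral => x _.
  by rewrite patchE indicE; case: ifP => _; rewrite ?mul1e ?mul0e.
have fA : nu A \is a fin_num by exact: fin_num_measure.
have fI : \int[mu]_(x in A) (g x)%:E \is a fin_num.
  exact: (integrable_fin_num _ (gA_integrable mA)).
have h3 : `|\int[mu]_(x in A) (g x)%:E| <= nu A.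
  apply: le_trans h2; apply: le_abse_integral => //.
  exact: measurable_funS mge.
move: h3; rewrite -(fineK fA) -(fineK fI) /= lee_fin ler_norml => /andP[h3 _].
by rewrite -EFinD lee_fin addrC -lerBlDr sub0r.
Qed.

Let law_sigma : semi_sigma_additive perturbed_law.
Proof.
move=> F mF tF mUF.
rewrite perturbed_lawE//.
have -> : (fun n => \sum_(0 <= i < n) perturbed_law (F i)) =
   (fun n => \sum_(0 <= i < n) nu (F i)) \+
   (fun n => \sum_(0 <= i < n) \int[mu]_(x in F i) (g x)%:E).
  apply/funext => n /=; rewrite -big_split/=; apply: eq_bigr => i _.
  by rewrite perturbed_lawE.
apply: cvgeD.
- by rewrite fin_num_adde_defr// fin_num_measure.
- exact: measure_semi_sigma_additive.
- exact: (@charge_semi_sigma_additive _ (measurableTypeR R) R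
    (induced_charge g_integrable) F mF tF mUF).
Qed.

HB.instance Definition _ :=
  isMeasure.Build _ _ _ perturbed_law law0 law_ge0 law_sigma.

Let law_setT : perturbed_law setT = 1.
Proof.
rewrite perturbed_lawE// probability_setT.
rewrite -[X in _ + X]fineK; last exact: integrable_fin_num.
by rewrite -[fine _]/(\int[mu]_x g x)%R g_int0 adde0.
Qed.

HB.instance Definition _ :=
  Measure_isProbability.Build _ _ _ perturbed_law law_setT.

Definition perturbed_prob : probability R R := perturbed_law.

Lemma integrable_mul_perturbation (f : R -> R) :
  nu.-integrable setT (EFin \o f) ->
  mu.-integrable setT (EFin \o (fun x => f x * g x)%R).
Proof.
move=> fi; have mf : measurable_fun [set: R] f.
  by apply/measurable_EFinP; case/integrableP: fi.
apply/integrableP; split.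
  by apply/measurable_EFinP; exact: measurable_funM.
case/integrableP: fi => mfe; apply: le_lt_trans.
have mfa : measurable_fun [set: R] (fun x => `|(f x)%:E|).
  exact: measurableT_comp.
apply: le_trans (dom mfa _) => //.
rewrite le_eqVlt; apply/orP; left; apply/eqP; apply: eq_integral => x _.
by rewrite /= normrM EFinM.
Qed.

Let gp x : R := Num.max (g x) 0%R.
Let gm x : R := Num.max (- g x)%R 0%R.
Let mgp : measurable_fun [set: R] gp.
Proof. exact: measurable_maxr. Qed.
Let mgm : measurable_fun [set: R] gm.
Proof. by apply: measurable_maxr => //; exact: measurable_funN. Qed.
Let gp0 x : (0 <= gp x)%R. Proof. by rewrite /gp le_max lexx orbT. Qed.
Let gm0 x : (0 <= gm x)%R. Proof. by rewrite /gm le_max lexx orbT. Qed.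
Let gpE x : (gp x = g x + gm x)%R.
Proof. by rewrite /gp /gm; case: (leP (g x)) => h; case: leP => h2; lra. Qed.
Let gm_le x : (gm x <= `|g x|)%R.
Proof. by rewrite /gm ge_max normr_ge0 -normrN ler_norm. Qed.

Let integrable_mul_gm (f : R -> R) : nu.-integrable setT (EFin \o f) ->
  mu.-integrable setT (EFin \o (fun x => f x * gm x)%R).
Proof.
move=> fi; have fg := integrable_mul_perturbation fi.
have mf : measurable_fun [set: R] f.
  by apply/measurable_EFinP; case/integrableP: fi.
apply: (le_integrable measurableT _ _ fg).
  by apply/measurable_EFinP; exact: measurable_funM.
move=> x _; rewrite /= lee_fin !normrM ler_wpM2l//.
by rewrite (ger0_norm (gm0 x)) gm_le.
Qed.

Let gm_integrable : mu.-integrable setT (EFin \o gm).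
Proof.
apply: (le_integrable measurableT _ _ g_integrable).
  exact/measurable_EFinP.
by move=> x _; rewrite /= lee_fin (ger0_norm (gm0 x)) gm_le.
Qed.

(** To stay among nonnegative measures, the negative part of [g] is moved to the
    other side. *)
Let decomposition (f : R -> \bar R) :
  measurable_fun setT f -> (forall x, 0 <= f x) ->
  \int[perturbed_law]_x f x + \int[mu]_x (f x * (gm x)%:E) =
  \int[nu]_x f x + \int[mu]_x (f x * (gp x)%:E).
Proof.
move=> mf f0.
rewrite -(ge0_integral_density_measure mgm gm0)//.
rewrite -(ge0_integral_density_measure mgp gp0)//.
rewrite -!ge0_integral_measure_add//.
apply: eq_measure_integral => A mA _.
apply: etrans (measure_addE _ _ _) _; apply: etrans (esym (measure_addE _ _ _)).
rewrite -[LHS]/(perturbed_law A + \int[mu]_(x in A) (gm x)%:E).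
rewrite -[RHS]/(nu A + \int[mu]_(x in A) (gp x)%:E).
rewrite perturbed_lawE// -addeA; congr (_ + _).
rewrite -integralD_EFin//.
- by apply: eq_integral => x _; rewrite gpE.
- exact: gA_integrable.
- by apply: integrableS gm_integrable.
Qed.

Let ge0_perturbed_integral (f : R -> R) : (forall x, 0 <= f x)%R ->
  nu.-integrable setT (EFin \o f) ->
  \int[perturbed_law]_x (f x)%:E = \int[nu]_x (f x)%:E + \int[mu]_x (f x * g x)%:E.
Proof.
move=> f0 fi; have mf : measurable_fun [set: R] (fun x => (f x)%:E).
  by case/integrableP: fi.
have := decomposition mf (fun x => f0 x : 0 <= (f x)%:E).
have im := integrable_mul_gm fi; have ig := integrable_mul_perturbation fi.
have -> : \int[mu]_x ((f x)%:E * (gp x)%:E) =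
    \int[mu]_x (f x * g x)%:E + \int[mu]_x (f x * gm x)%:E.
  rewrite -integralD_EFin//; apply: eq_integral => x _.
  by rewrite gpE -EFinM mulrDr.
have fm : \int[mu]_x (f x * gm x)%:E \is a fin_num.
  exact: (integrable_fin_num _ im).
by rewrite addeA => /(congr1 (fun t => t - \int[mu]_x (f x * gm x)%:E)); rewrite !addeK.
Qed.

(** Reduced to nonnegative integrands through [f = |f| - (|f| - f)]. *)
Lemma perturbed_integral (f : R -> R) : nu.-integrable setT (EFin \o f) ->
  perturbed_prob.-integrable setT (EFin \o f) /\
  (\int[perturbed_prob]_x f x = \int[nu]_x f x + \int[mu]_x (f x * g x))%R.
Proof.
move=> fi; have mf : measurable_fun [set: R] f.
  by apply/measurable_EFinP; case/integrableP: fi.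
have Qfin (h : R -> R) : (forall x, 0 <= h x)%R ->
    nu.-integrable setT (EFin \o h) -> perturbed_prob.-integrable setT (EFin \o h) /\
    (\int[perturbed_prob]_x h x = \int[nu]_x h x + \int[mu]_x (h x * g x))%R.
  move=> h0 hi; have E := ge0_perturbed_integral h0 hi.
  have f1 : \int[nu]_x (h x)%:E \is a fin_num by exact: (integrable_fin_num _ hi).
  have f2 : \int[mu]_x (h x * g x)%:E \is a fin_num.
    exact: (integrable_fin_num _ (integrable_mul_perturbation hi)).
  split; last by rewrite /Rintegral E fineD.
  apply/integrableP; split; first by case/integrableP: hi.
  under eq_integral do rewrite /= (ger0_norm (h0 _)).
  by rewrite E ltey_eq fin_numD f1 f2.
pose u x : R := `|f x|%R; pose v x : R := (`|f x| - f x)%R.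
have ui : nu.-integrable setT (EFin \o u) by exact: integrable_norm.
have vi : nu.-integrable setT (EFin \o v).
  rewrite (_ : EFin \o v = (EFin \o u) \- (EFin \o f))//; exact: integrableB.
have [Qu Eu] := Qfin u (fun x => normr_ge0 _) ui.
have [Qv Ev] := Qfin v (fun x => etrans (subr_ge0 _ _) (ler_norm _)) vi.
(* both [u] and [v] are nonnegative *)
have fE x : (f x = u x - v x)%R by rewrite /u /v opprB addrC subrK.
have fi' : perturbed_prob.-integrable setT (EFin \o f).
  rewrite (_ : EFin \o f = (EFin \o u) \- (EFin \o v)); first exact: integrableB.
  by apply/funext => x; rewrite /= fE EFinB.
split => //.
have E (m : probability R R) : m.-integrable setT (EFin \o u) ->
    m.-integrable setT (EFin \o v) ->
    (\int[m]_x f x = \int[m]_x u x - \int[m]_x v x)%R.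
  by move=> mu' mv'; rewrite -RintegralB//; apply: eq_Rintegral => x _; exact: fE.
rewrite (E _ Qu Qv) (E _ ui vi) Eu Ev.
have iu := integrable_mul_perturbation ui.
have iv := integrable_mul_perturbation vi.
have -> : (\int[mu]_x (f x * g x) = \int[mu]_x (u x * g x) - \int[mu]_x (v x * g x))%R.
  by rewrite -RintegralB//; apply: eq_Rintegral => x _; rewrite -mulrBl -fE.
by ring.
Qed.
End perturbed_law.

(** * An oscillating density with zero moments *)

Section oscillation.
Context (R : realType).
Local Notation mu := (@lebesgue_measure R).

(** With the exponent [4 * m + 3], the phase [(4 * m + 4) * pi / 2] of the
    rotated Gamma integral is a multiple of [2 * pi]. *)
Definition oscillation (m : nat) (C r b x : R) : R :=
  `|x| ^+ (4 * m + 3) * expR (- (C * `|x| `^ r)) * sin (b * `|x| `^ r).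

Lemma measurable_oscillation (m : nat) (C r b : R) :
  measurable_fun [set: R] (oscillation m C r b).
Proof.
have ma := @measurable_abs_powR R r.
apply: measurable_funM; first apply: measurable_funM.
- by apply: measurable_funX; exact: normr_measurable.
- apply: (measurableT_comp (@measurable_expR R)); apply: measurable_funN.
  exact: measurable_funM.
- apply: (measurableT_comp (continuous_measurable_fun (@continuous_sin R))).
  exact: measurable_funM.
Qed.

(** Odd moments vanish by parity.  For even k the phase of the rotated integrand,
    [(4 * m + 4 + k) / r * T] with [T = pi * r / 2], is a multiple of [pi], so
    that on the positive half-line the integrand is, up to sign,
    [rot_integrand]. *)
Lemma oscillation_moment0 (m k : nat) (C r : R) : 0 < C -> 0 < r < 1 ->
  let T := pi * r / 2 in
  mu.-integrable setT
    (EFin \o (fun x => x ^+ k * oscillation m C r (C / cos T * sin T) x)) ->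
  \int[mu]_x (x ^+ k * oscillation m C r (C / cos T * sin T) x) = 0.
Proof.
move=> C0 /andP[r0 r1] T fi.
have T0 : 0 <= T by rewrite divr_ge0// mulr_ge0 ?pi_ge0// ltW.
have T1 : T < pi / 2 by rewrite /T ltr_pM2r ?invr_gt0// -[ltRHS]mulr1 ltr_pM2l ?pi_gt0.
have cT : 0 < cos T.
  by rewrite cos_gt0_pihalf// T1 andbT (lt_le_trans _ T0)// oppr_lt0 divr_gt0 ?pi_gt0.
apply: (integral_half_line_eq0 fi).
  by rewrite /oscillation normr0 addn3 [0 ^+ _.+3]exprS !mul0r mulr0.
have [ok|ek] := boolP (odd k); [left|right].
  move=> x; rewrite /oscillation normrN exprNn.
  by rewrite -signr_odd ok expr1 mulN1r mulNr.
split=> [x|].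
  by rewrite /oscillation normrN exprNn -signr_odd (negbTE ek) expr0 mul1r.
pose s := C / cos T; pose q := (4 * m + 3 + k)%N.
have s0 : 0 < s by rewrite divr_gt0.
pose n := (m.+1.*2 + k./2)%N.
have qE : q.+1 = n.*2.
  rewrite /q /n doubleD even_halfK// -addSn -addnS; congr (_ + _)%N.
  by rewrite -!muln2; ring.
(* [s * cos T = C], and removing [n] half turns from the phase gives a sign *)
have E x : 0 < x -> x ^+ k * oscillation m C r (s * sin T) x =
    (-1) ^+ n * rot_integrand q s r x T.
  move=> x0; rewrite /oscillation /rot_integrand /rot_damping /rot_phase.
  rewrite (gtr0_norm x0).
  have -> : s * x `^ r * cos T = C * x `^ r.
    by rewrite /s mulrAC divfK// gt_eqF.
  have -> : q.+1%:R / r * T = pi *+ n.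
    rewrite qE -muln2 natrM /T -mulr_natl; field.
    by rewrite gt_eqF.
  have -> : sin (s * sin T * x `^ r) =
      (-1) ^+ n * sin (s * x `^ r * sin T - pi *+ n).
    rewrite -[in LHS](subrK (pi *+ n) (s * sin T * x `^ r)).
    rewrite (alternatingn (@sinDpi R)).
    by rewrite [s * sin T * _]mulrAC.
  rewrite /q [x ^+ (4 * m + 3 + k)]exprD.
  move: (x ^+ k) (x ^+ _) ((-1) ^+ n) (sin _) (expR _) => *.
  by ring.
pose D : set R := `]0, +oo[%classic.
have mD : measurable D by exact: measurable_itv.
have DE x : x \in D -> x ^+ k * oscillation m C r (s * sin T) x =
    (-1) ^+ n * rot_integrand q s r x T.
  by rewrite inE /D/= in_itv/= andbT; exact: E.
have iD : mu.-integrable D (EFin \o (rot_integrand q s r ^~ T)).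
  have i1 : mu.-integrable D
    (EFin \o (fun x => (-1) ^+ n * (x ^+ k * oscillation m C r (s * sin T) x))).
    by apply: integrable_realZl => //; apply: integrableS fi.
  apply: (@eq_integrable _ (measurableTypeR R) R mu D mD _ _ _ i1) => x xD /=.
  by rewrite DE// mulrA -exprD addnn -mul2n exprM sqrrN !expr1n mul1r.
transitivity (\int[mu]_(x in D) ((-1) ^+ n * rot_integrand q s r x T)).
  by apply: eq_Rintegral => x xD; exact: DE.
rewrite RintegralZl// (integral_rot_integrand_eq0 s0 r0 _ iD) ?mulr0//.
by rewrite T0.
Qed.

(** The power [|x| ^ (4 * m + 3 - B)] is absorbed by raising the rate from [C] to
    [C + 1]. *)
Lemma oscillation_le (m : nat) (c B C r b : R) :
  0 < c -> 0 < C -> 0 < r -> B <= (4 * m + 3)%:R ->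
  exists2 e : R, 0 < e &
    forall x, `|e * oscillation m (C + 1) r b x| <= stretched_exp c B C r x.
Proof.
move=> c0 C0 r0 Bm.
have e0 : 0 <= (4 * m + 3)%:R - B by rewrite subr_ge0.
have [K K0 HK] := powR_le_expR_powR e0 r0 (ltr01 : 0 < 1 :> R).
exists (c / K); first by rewrite divr_gt0.
move=> x; rewrite normrM (gtr0_norm (_ : 0 < c / K)) ?divr_gt0//.
rewrite /stretched_exp -mulrA ler_wpM2l ?(ltW c0)//.
rewrite mulrC ler_pdivrMr// /oscillation normrM.
apply: (@le_trans _ _ (`|x| ^+ (4 * m + 3) * expR (- ((C + 1) * `|x| `^ r)))).
  rewrite ger0_norm ?mulr_ge0 ?exprn_ge0 ?expR_ge0//.
  by rewrite ler_piMr ?sin_max// mulr_ge0 ?exprn_ge0 ?expR_ge0.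
have [->|x0] := eqVneq x 0.
  rewrite normr0 addn3 [0 ^+ _.+3]exprS !mul0r.
  by rewrite !mulr_ge0 ?powR_ge0 ?expR_ge0 ?(ltW K0).
have ax : 0 < `|x| by rewrite normr_gt0.
rewrite -powR_mulrn// -[X in `|x| `^ X](subrK B) powRD ?(gt_eqF ax) ?implybT//.
rewrite mulrDl opprD expRD mul1r.
have := HK `|x| (ltW ax); rewrite mul1r => h.
have h' : `|x| `^ ((4 * m + 3)%:R - B) * expR (- `|x| `^ r) <= K.
  by rewrite expRN ler_pdivrMr ?expR_gt0.
have w0 : 0 <= `|x| `^ B * expR (- (C * `|x| `^ r)).
  by rewrite mulr_ge0 ?powR_ge0 ?expR_ge0.
rewrite [leRHS]mulrC; apply: le_trans (ler_wpM2r w0 h').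
by rewrite le_eqVlt; apply/orP; left; apply/eqP; ring.
Qed.

End oscillation.

(** * Indeterminacy from a minorant *)

Section indeterminacy.
Context (d : measure_display) (T : measurableType d) (R : realType)
  (P : probability T R).
Local Notation mu := (@lebesgue_measure R).

(** Add a small multiple of an oscillating density to the law.  All moments are
    preserved, while the mass of a right neighbourhood of 0, where the added
    density is positive, increases. *)
Lemma stretched_minorant_not_M_det (X : {RV P >-> R}) (r : R) :
  0 < r < 1 -> stretched_minorant P X r -> ~ M_det P X.
Proof.
move=> r01 [c [B [C [c0 C0 HX]]]] [fX det]; have /andP[r0 r1] := r01.
(* the power of [|x|] in the oscillation must be at least [B] *)
pose m := Num.bound `|B|.
have Bm : B <= (4 * m + 3)%:R.
  apply: le_trans (ler_norm B) _; apply: le_trans (ltW (archi_boundP _)) _ => //.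
  by rewrite ler_nat -/m -[leqLHS]addn0 leq_add// leq_pmull.
have C1 : 0 < C + 1 by rewrite addr_gt0.
pose th := pi * r / 2; pose b := (C + 1) / cos th * sin th.
have [e e0 gle] := oscillation_le b c0 C0 r0 Bm.
pose g x := e * oscillation m (C + 1) r b x.
have mosc := measurable_oscillation m (C + 1) r b.
have mg : measurable_fun [set: R] g by exact: measurable_funM.
have mw := measurable_stretched_exp c B C r.
have dom (f : R -> \bar R) : measurable_fun setT f -> (forall x, 0 <= f x)%E ->
    (\int[mu]_x (f x * `|g x|%:E) <= \int[distribution P X]_x f x)%E.
  move=> mf f0; rewrite ge0_integral_distribution//.
  apply: le_trans (HX f mf f0); apply: ge0_le_integral => //.
  - by move=> x _; rewrite mule_ge0// lee_fin.
  - apply: emeasurable_funM => //; apply/measurable_EFinP.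
    exact: measurableT_comp.
  - by apply: emeasurable_funM => //; exact/measurable_EFinP.
  - by move=> x _; rewrite lee_wpmul2l// lee_fin; exact: gle.
have mpow k : measurable_fun [set: R] (fun x : R => (x ^+ k)%:E).
  by apply/measurable_EFinP; exact: exprn_measurable.
have iX' k : (distribution P X).-integrable [set: R] (fun x => (x ^+ k)%:E).
  by apply: integrable_pushforward => //; rewrite preimage_setT; exact: fX.
have iX k : (distribution P X).-integrable [set: R] (EFin \o (fun x => x ^+ k)).
  exact: iX'.
have pg k : \int[mu]_x (x ^+ k * g x) = 0.
  have ig := integrable_mul_perturbation mg dom (iX k).
  have ei : mu.-integrable setT
      (EFin \o (fun x => x ^+ k * oscillation m (C + 1) r b x)).
    have := integrable_realZl e^-1 measurableT ig.
    apply: eq_integrable => // x _ /=.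
    by rewrite /g mulrCA mulKf// gt_eqF.
  transitivity (\int[mu]_x (e * (x ^+ k * oscillation m (C + 1) r b x))).
    by apply: eq_Rintegral => x _; rewrite mulrCA.
  by rewrite RintegralZl// (oscillation_moment0 C1 r01 ei) mulr0.
have g0 : \int[mu]_x g x = 0.
  by rewrite -(pg 0%N); apply: eq_Rintegral => x _; rewrite expr0 mul1r.
pose Q := perturbed_prob mg dom g0.
have QE k : Q.-integrable setT (EFin \o (fun x => x ^+ k)) /\
    \int[Q]_x (x ^+ k) = \int[distribution P X]_x (x ^+ k).
  have [iQ EQ] := perturbed_integral mg dom g0 (iX k).
  by split => //; rewrite EQ pg addr0.
have fQ : finite_moments Q id by move=> k; case: (QE k).
have mQ (k : nat) : (0 < k)%N -> moment Q id k = moment P X k.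
  move=> _; rewrite /moment unlock.
  have [iQ EQ] := QE k.
  have E : (\int[distribution P X]_x (x ^+ k)%:E = \int[P]_w (X w ^+ k)%:E)%E.
    by rewrite integral_distribution//; exact: fX.
  rewrite -E -[LHS]fineK; last exact: (integrable_fin_num _ iQ).
  rewrite -[RHS]fineK; last exact: (integrable_fin_num _ (iX k)).
  exact: (congr1 EFin EQ).
have intA0 (A : set R) : measurable A -> (\int[mu]_(x in A) (g x)%:E = 0)%E.
  move=> mA; have := det Q fQ mQ A mA.
  rewrite (_ : Q A = perturbed_law (distribution P X) g A)// perturbed_lawE//.
  move=> /(congr1 (fun t => (t - distribution P X A)%E)).
  rewrite [(_ + \int[mu]_(x in A) _)%E]addeC addeK ?fin_num_measure//.
  by rewrite subee// fin_num_measure.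
have th0 : 0 < th by rewrite /th divr_gt0// mulr_gt0// pi_gt0.
have th1 : th < pi / 2.
  by rewrite /th ltr_pM2r ?invr_gt0// -[ltRHS]mulr1 ltr_pM2l ?pi_gt0.
have cth : 0 < cos th.
  by rewrite cos_gt0_pihalf// th1 andbT (lt_trans _ th0)// oppr_lt0 divr_gt0 ?pi_gt0.
have sth : 0 < sin th by rewrite sin_gt0_pihalf// th0.
have b0 : 0 < b by rewrite !mulr_gt0 ?invr_gt0.
(* up to [a] the argument of the sine stays in ]0, pi[ *)
pose a := (pi / b) `^ r^-1.
have a0 : 0 < a by rewrite powR_gt0// divr_gt0 ?pi_gt0.
pose A : set R := `]0, a[%classic.
have mA : measurable A by exact: measurable_itv.
have gpos x : A x -> 0 < g x.
  rewrite /A/= in_itv/= => /andP[x0 xa].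
  rewrite /g /oscillation (gtr0_norm x0) !mulr_gt0 ?exprn_gt0 ?expR_gt0//.
  rewrite sin_gt0_pi// mulr_gt0 ?powR_gt0//=.
  rewrite mulrC -ltr_pdivlMr//.
  have -> : pi / b = a `^ r.
    rewrite /a -powRrM mulVf ?gt_eqF// powRr1//.
    by rewrite divr_ge0 ?pi_ge0 ?ltW.
  by rewrite gt0_ltr_powR ?nnegrE// ltW.
have mgA : measurable_fun A (fun x => (g x)%:E).
  by apply/measurable_EFinP; exact: measurable_funTS.
have absA : (\int[mu]_(x in A) `|(g x)%:E| = 0)%E.
  rewrite -[RHS](intA0 A mA); apply: eq_integral => x; rewrite inE => xA.
  by rewrite gee0_abs// lee_fin ltW// gpos.
have := (ae_eq_integral_abs mu
  (mA : measurable (A : set (measurableTypeR R))) mgA).1 absA.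
move=> [N [mN N0 AN]].
have subN : A `<=` N.
  move=> x Ax; apply: AN => /= /(_ Ax) [g0x].
  by have := gpos x Ax; rewrite g0x ltxx.
have : (mu A <= mu N)%E by apply: le_measure => //; rewrite inE.
rewrite [mu N]N0 lebesgue_measure_itv/= lte_fin a0 -EFinB subr0 lee_fin.
by rewrite leNgt a0.
Qed.

End indeterminacy.

(** * The moment problem for products of DGG variables *)

Lemma partial_sumS (R : realType) (n : nat) (f : 'I_n -> R) (i : 'I_n) :
  \sum_(j < n | (j < i.+1)%N) f j = \sum_(j < n | (j < i)%N) f j + f i.
Proof.
rewrite (bigD1 i)//= addrC; congr (_ + _).
by apply: eq_bigl => j; rewrite ltnS [RHS]ltn_neqAle -val_eqE andbC.
Qed.

Theorem corollary3 (R : realType) (d : measure_display) (T : measurableType d)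
  (P : probability T R) (n : nat) (hn : (0 < n)%N)
  (alpha beta gamma : 'I_n -> R)
  (halpha : forall i, 0 < alpha i)
  (hbeta : forall i, 0 < beta i)
  (hgamma : forall i, 0 < gamma i)
  (xi : 'I_n -> {RV P >-> R})
  (hindep : independent_RVs P xi)
  (hxi : forall i, DGG P (xi i) (alpha i) (beta i) (gamma i)) :
  M_det P (\prod_(i < n) (xi i : {mfun T >-> R})) <->
  \sum_(i < n) (beta i)^-1 <= 1.
Proof.
pose s m := \sum_(j < n | (j < m)%N) (beta j)^-1.
have s0 : s 0%N = 0 by rewrite /s big_pred0.
have sS (i : 'I_n) : s i.+1 = s i + (beta i)^-1 by exact: partial_sumS.
have sn : s n = \sum_(i < n) (beta i)^-1.
  by apply: eq_bigl => j; rewrite ltn_ord.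
rewrite -sn; split=> [det|s1].
- rewrite leNgt; apply/negP => s1; move: det.
  have : (n = 0%N /\ \prod_(i < n) (xi i : {mfun T >-> R}) = 1) \/
      (0 < s n /\
       stretched_minorant P (\prod_(i < n) (xi i : {mfun T >-> R})) (s n)^-1).
    apply: (independent_prod_ind hindep (Phi := fun m W => (m = 0%N /\ W = 1) \/
      (0 < s m /\ stretched_minorant P W (s m)^-1))); first by left.
    move=> i W WX H; right; have bi : 0 < (beta i)^-1 by rewrite invr_gt0.
    have Hi := dgg_stretched_minorant (halpha i) (hbeta i) (hxi i).
    rewrite sS; case: H => [[-> ->]|[si HW]].
      by rewrite s0 add0r mul1r invrK.
    split; first exact: addr_gt0.
    rewrite -[X in (X + _)^-1]invrK.
    by apply: stretched_minorantM => //; rewrite invr_gt0.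
  case=> [[n0 _]|[sn0 H]]; first by rewrite n0 in hn.
  apply: (stretched_minorant_not_M_det (r := (s n)^-1)) => //.
  by rewrite invr_gt0 sn0/= invf_lt1.
- apply: (@moment_growth_M_det _ _ _ _ _ (s n)) => //.
  apply: (independent_prod_ind hindep (Phi := fun m W => moment_growth P W (s m))).
    by rewrite s0; exact: moment_growth1.
  move=> i W WX HW; rewrite sS; apply: moment_growthM => //.
  exact: dgg_moment_growth (halpha i) (hbeta i) (hxi i).
Qed.
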